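(* For any field $k$ there exists a unique morphism of props $$\blacksquare\colon\mathrm{Circ}_k\cong\mathrm{FinCospan}+F(k)\to\mathrm{LagRel}_k$$ such that $\blacksquare|_{\mathrm{FinCospan}}$ is the composite $\mathrm{FinCospan}\xrightarrow{H}\mathrm{FinCorel}\xrightarrow{K}\mathrm{LagRel}_k$ and for each $Z\in k$, the linear Lagrangian relation $\blacksquare(Z)$ from $k\oplus k$ to $k\oplus k$ is given by $$\blacksquare(Z)=\{(\phi_1,I_1,\phi_2,I_2):\ \phi_2-\phi_1=ZI_1,\ I_1=I_2\}.$$
   Context: A prop is a strict symmetric monoidal category with objects the natural numbers and tensor product of objects given by addition; a morphism of props is a strict symmetric monoidal functor that is the identity on objects; $+$ denotes coproduct of props. $\mathrm{FinCospan}$ is the prop whose morphisms $m\to n$ are isomorphism classes of cospans of finite sets $X\to N\leftarrow Y$ with $|X|=m$, $|Y|=n$, composed by pushout. $\mathrm{FinCorel}$ is the prop whose morphisms are jointly epic such cospans (equivalently partitions of $X+Y$), composed by pushout followed by restriction of the apex to the joint image. $H$ restricts the apex of a cospan to the joint image of its legs. $\mathrm{Circ}_k$ is the prop whose morphisms $m\to n$ are isomorphism classes of cospans of finite sets $X\to N\leftarrow Y$ with a finite edge set $E$, source and target maps $E\rightrightarrows N$ and a labelling $E\to k$; composition is by pushout of node sets and disjoint union of edge sets. $\mathrm{Circ}_k\cong\mathrm{FinCospan}+F(k)$, with $F(k)$ the free prop with one generator $Z\colon1\to1$ for each $Z\in k$ (a single edge labelled $Z$ from input to output). A symplectic vector space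 is a finite-dimensional vector space with a bilinear, alternating, nondegenerate form $\omega$; $\overline V$ has form $-\omega$; a Lagrangian subspace is a maximal isotropic subspace. $k\oplus k$ has $\omega((\phi,I),(\phi',I'))=\phi I'-\phi' I$, and $(k\oplus k)^n$ the direct sum form. $\mathrm{LagRel}_k$ is the prop whose morphisms $m\to n$ are linear Lagrangian relations from $(k\oplus k)^m$ to $(k\oplus k)^n$, i.e. Lagrangian subspaces of $\overline{(k\oplus k)^m}\oplus(k\oplus k)^n$, with relation composition and direct sum. $K\colon\mathrm{FinCorel}\to\mathrm{LagRel}_k$ is the morphism of props sending the one-part corelations $2\to1$, $1\to2$, $0\to1$, $1\to0$ to, respectively, $\{\phi_1=\phi_2=\phi_3,\ I_1+I_2=I_3\}$, $\{\phi_1=\phi_2=\phi_3,\ I_1=I_2+I_3\}$, $\{I=0\}$, $\{I=0\}$, in coordinates $(\phi_j,I_j)$ on the copies of $k\oplus k$, inputs listed first. *)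

(* Defs.v *)
From HB Require Import structures.
From mathcomp Require Import all_boot all_order all_algebra.
From mathcomp Require Import boolp.

Set Implicit Arguments.
Unset Strict Implicit.
Unset Printing Implicit Defensive.

Import GRing.Theory.

(* Composition is written in diagrammatic order. *)
Record prop_ops := PropOps {
  hom : nat -> nat -> Type;
  idm : forall m, hom m m;
  compm : forall m n p, hom m n -> hom n p -> hom m p;
  tensm : forall m n m' n', hom m n -> hom m' n' -> hom (m + m') (n + n');
  symm : forall m n, hom (m + n) (n + m) }.

Arguments idm {p} m : rename.
Arguments compm {p m n p0} f g : rename.
Arguments tensm {p m n m' n'} f g : rename.
Arguments symm {p} m n : rename.

(* The monoidal structure is strict, but m + (n + p) and (m + n) + p are only *)
(* propositionally equal, so the strictness equations are stated up to        *)
(* transport along the equalities of objects.                                 *)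
Definition castm (P : prop_ops) m m' n n' (em : m = m') (en : n = n')
    (f : hom P m n) : hom P m' n' :=
  let: erefl := em in let: erefl := en in f.

Record is_prop (P : prop_ops) : Prop := IsProp {
  comp_id_l : forall m n (f : hom P m n), compm (idm m) f = f;
  comp_id_r : forall m n (f : hom P m n), compm f (idm n) = f;
  comp_assoc : forall m n p q (f : hom P m n) (g : hom P n p) (h : hom P p q),
    compm f (compm g h) = compm (compm f g) h;
  tens_id : forall m n, tensm (idm m) (idm n) = idm (m + n) :> hom P _ _;
  tens_comp : forall m n p m' n' p' (f : hom P m n) (g : hom P n p)
      (f' : hom P m' n') (g' : hom P n' p'),
    tensm (compm f g) (compm f' g') = compm (tensm f f') (tensm g g');
  tens_assoc : forall m n m' n' m'' n''
      (f : hom P m n) (f' : hom P m' n') (f'' : hom P m'' n''),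
    castm (addnA m m' m'') (addnA n n' n'') (tensm f (tensm f' f'')) =
    tensm (tensm f f') f'';
  tens_unit_l : forall m n (f : hom P m n),
    castm (add0n m) (add0n n) (tensm (idm 0) f) = f;
  tens_unit_r : forall m n (f : hom P m n),
    castm (addn0 m) (addn0 n) (tensm f (idm 0)) = f;
  sym_natural : forall m n m' n' (f : hom P m n) (f' : hom P m' n'),
    compm (tensm f f') (symm n n') = compm (symm m m') (tensm f' f);
  sym_involutive : forall m n,
    compm (symm m n) (symm n m) = idm (m + n) :> hom P _ _;
  sym_hexagon : forall m n p,
    symm m (n + p) =
    compm (castm (esym (addnA m n p)) (esym (addnA n m p))
            (tensm (symm m n) (idm p)))
         (castm erefl (addnA n p m) (tensm (idm n) (symm m p))) :> hom P _ _ }.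

Record prop := MkProp { ops :> prop_ops; propP : is_prop ops }.

Record is_prop_morphism (P Q : prop_ops)
    (F : forall m n, hom P m n -> hom Q m n) : Prop := IsPropMorphism {
  pres_id : forall m, F m m (idm m) = idm m;
  pres_comp : forall m n p (f : hom P m n) (g : hom P n p),
    F m p (compm f g) = compm (F m n f) (F n p g);
  pres_tens : forall m n m' n' (f : hom P m n) (g : hom P m' n'),
    F _ _ (tensm f g) = tensm (F m n f) (F m' n' g);
  pres_sym : forall m n, F _ _ (symm m n) = symm m n }.

Record prop_morphism (P Q : prop) := PropMorphism {
  morph_fun :> forall m n, hom P m n -> hom Q m n;
  morphP : is_prop_morphism morph_fun }.

Arguments morph_fun {P Q} _ {m n} f.

Lemma prop_morphism_eq (P Q : prop) (F G : prop_morphism P Q) :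
  (forall m n (f : hom P m n), F _ _ f = G _ _ f) -> F = G.
Proof.
case: F G => [F HF] [G HG] /= FG.
have e : F = G.
  by apply: functional_extensionality_dep => m;
     apply: functional_extensionality_dep => n; apply: funext => f.
by subst G; congr PropMorphism; apply: Prop_irrelevance.
Qed.

Lemma comp_is_prop_morphism (P Q R : prop)
    (G : prop_morphism Q R) (F : prop_morphism P Q) :
  is_prop_morphism (fun m n (f : hom P m n) => G m n (F m n f)).
Proof.
case: F G => [F [F1 F2 F3 F4]] [G [G1 G2 G3 G4]] /=.
by split=> *; rewrite ?(F1, F2, F3, F4) ?(G1, G2, G3, G4).
Qed.

Definition morph_comp (P Q R : prop)
    (G : prop_morphism Q R) (F : prop_morphism P Q) : prop_morphism P R :=
  PropMorphism (comp_is_prop_morphism G F).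

Lemma morph_cast (P Q : prop_ops) (F : forall m n, hom P m n -> hom Q m n)
    m m' n n' (em : m = m') (en : n = n') (f : hom P m n) :
  F _ _ (castm em en f) = castm em en (F _ _ f).
Proof. by case: _ / em; case: _ / en. Qed.

Lemma is_prop_inj (P : prop_ops) (Q : prop)
    (F : forall m n, hom P m n -> hom Q m n) :
  is_prop_morphism F -> (forall m n, injective (F m n)) -> is_prop P.
Proof.
case=> F1 F2 F3 F4 Finj; case: (propP Q) => *.
by split=> *; apply: Finj; rewrite ?(morph_cast F, F1, F2, F3, F4).
Qed.

Lemma is_prop_surj (P : prop) (Q : prop_ops)
    (F : forall m n, hom P m n -> hom Q m n) :
  is_prop_morphism F -> (forall m n g, exists f, F m n f = g) -> is_prop Q.
Proof.
case=> F1 F2 F3 F4 Fsurj; case: (propP P) => h1 h2 h3 h4 h5 h6 h7 h8 h9 h10 h11.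
split.
- by move=> m n f; case: (Fsurj _ _ f) => {}f <-; rewrite -F1 -F2 h1.
- by move=> m n f; case: (Fsurj _ _ f) => {}f <-; rewrite -F1 -F2 h2.
- move=> m n p q f g h; case: (Fsurj _ _ f) => {}f <-.
  by case: (Fsurj _ _ g) => {}g <-; case: (Fsurj _ _ h) => {}h <-; rewrite -!F2 h3.
- by move=> m n; rewrite -!F1 -F3 h4.
- move=> m n p m' n' p' f g f' g'; case: (Fsurj _ _ f) => {}f <-.
  case: (Fsurj _ _ g) => {}g <-; case: (Fsurj _ _ f') => {}f' <-.
  by case: (Fsurj _ _ g') => {}g' <-; rewrite -!(F2, F3) h5.
- move=> m n m' n' m'' n'' f f' f''; case: (Fsurj _ _ f) => {}f <-.
  case: (Fsurj _ _ f') => {}f' <-; case: (Fsurj _ _ f'') => {}f'' <-.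
  by rewrite -!F3 -morph_cast h6.
- by move=> m n f; case: (Fsurj _ _ f) => {}f <-; rewrite -F1 -F3 -morph_cast h7.
- by move=> m n f; case: (Fsurj _ _ f) => {}f <-; rewrite -F1 -F3 -morph_cast h8.
- move=> m n m' n' f f'; case: (Fsurj _ _ f) => {}f <-.
  by case: (Fsurj _ _ f') => {}f' <-; rewrite -!F3 -!F4 -!F2 h9.
- by move=> m n; rewrite -!F4 -F2 -F1 h10.
- by move=> m n p; rewrite -!(F1, F4) -!F3 -!morph_cast -F2 -h11.
Qed.

(* {eq_quot _} requires a choiceType of representatives; cospans with an      *)
(* arbitrary finType as apex live in too large a universe for that.           *)
Definition quot (T : Type) (R : T -> T -> Prop) :=
  {C : T -> Prop | exists x, C = R x}.

Definition cls (T : Type) (R : T -> T -> Prop) (x : T) : quot R :=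
  exist _ (R x) (ex_intro _ x erefl).

Definition qrepr (T : Type) (R : T -> T -> Prop) (q : quot R) : T :=
  sval (cid (svalP q)).

Lemma reprK (T : Type) (R : T -> T -> Prop) (q : quot R) : cls R (qrepr q) = q.
Proof.
case: q => C hC; apply: eq_exist; rewrite /qrepr; case: cid => x /= eC.
exact: esym eC.
Qed.

Record equivalence (T : Type) (R : T -> T -> Prop) : Prop := Equivalence {
  eqv_refl : forall x, R x x;
  eqv_sym : forall x y, R x y -> R y x;
  eqv_trans : forall x y z, R x y -> R y z -> R x z }.

Lemma clsP (T : Type) (R : T -> T -> Prop) : equivalence R ->
  forall x y, cls R x = cls R y <-> R x y.
Proof.
case=> r s t x y; split=> [/(congr1 sval) /= -> // | Rxy]; apply: eq_exist.
by apply: funext => z; apply: propext; split; apply: t => //; apply: s.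
Qed.

Lemma repr_cls (T : Type) (R : T -> T -> Prop) : equivalence R ->
  forall x, R (qrepr (cls R x)) x.
Proof. by move=> eR x; apply/(clsP eR); rewrite reprK. Qed.

Section Pushout.
Variables (A B C : finType) (f : A -> B) (g : A -> C).

Definition glue : rel (B + C) := fun u v =>
  [exists a, (u == inl (f a)) && (v == inr (g a))
          || (v == inl (f a)) && (u == inr (g a))].

Definition pushout : finType := {u : B + C | fingraph.root glue u == u}.

Lemma glue_connect_sym : connect_sym glue.
Proof.
apply: sym_connect_sym => u v; apply/existsP/existsP => -[a Ha];
by exists a; rewrite orbC.
Qed.

Definition po (u : B + C) : pushout :=
  exist _ (fingraph.root glue u) (introT eqP (root_root glue_connect_sym u)).
Definition po_l (b : B) : pushout := po (inl b).
Definition po_r (c : C) : pushout := po (inr c).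

Definition po_desc T (h : B -> T) (h' : C -> T) (p : pushout) : T :=
  match val p with inl b => h b | inr c => h' c end.

Lemma po_glue a : po_l (f a) = po_r (g a).
Proof.
apply/val_inj => /=; apply/(fingraph.rootP glue_connect_sym).
by apply/connect1/existsP; exists a; rewrite !eqxx.
Qed.

Variant po_spec : pushout -> Prop :=
  | PoL b : po_spec (po_l b)
  | PoR c : po_spec (po_r c).

Lemma poP p : po_spec p.
Proof.
have -> : p = po (val p).
  by apply/val_inj/esym/eqP; exact: (valP p).
by case: (val p) => [b|c]; [exact: PoL|exact: PoR].
Qed.

Section Desc.
Variables (T : Type) (h : B -> T) (h' : C -> T).
Hypothesis hh' : forall a, h (f a) = h' (g a).

Let hs (u : B + C) : T := match u with inl b => h b | inr c => h' c end.

Lemma po_descE u : po_desc h h' (po u) = hs u.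
Proof.
rewrite -[LHS]/(hs (fingraph.root glue u)).
have /connectP[s + ->] := connect_root glue u.
elim: s u => //= v s IH u /andP[/existsP[a Ha] /IH ->].
by case/orP: Ha => /andP[/eqP-> /eqP->] /=; rewrite hh'.
Qed.

Lemma po_desc_l b : po_desc h h' (po_l b) = h b.
Proof. exact: po_descE. Qed.
Lemma po_desc_r c : po_desc h h' (po_r c) = h' c.
Proof. exact: po_descE. Qed.
End Desc.
End Pushout.

Arguments po_l {A B C f g} b.
Arguments po_r {A B C f g} c.
Arguments po_desc {A B C f g T} h h' p.

(* Every morphism has a representative whose feet are the standard finite     *)
(* sets 'I_m and 'I_n; the apex ranges over all finite sets.                  *)
Record cospan (m n : nat) := Cospan {
  apex : finType;
  lin : 'I_m -> apex;
  lout : 'I_n -> apex }.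

Definition cospan_iso m n (c d : cospan m n) : Prop :=
  exists f : apex c -> apex d,
    [/\ bijective f, forall i, f (lin c i) = lin d i &
        forall j, f (lout c j) = lout d j].

Definition cospan_id m : cospan m m := @Cospan m m 'I_m id id.

Definition cospan_comp m n p (c : cospan m n) (d : cospan n p) : cospan m p :=
  @Cospan m p (pushout (lout c) (lin d))
    (fun i => po_l (lin c i)) (fun j => po_r (lout d j)).

Definition tens_leg m n (A B : Type) (f : 'I_m -> A) (g : 'I_n -> B)
    (i : 'I_(m + n)) : A + B :=
  match split i with inl j => inl (f j) | inr j => inr (g j) end.

Definition cospan_tens m n m' n' (c : cospan m n) (d : cospan m' n') :
    cospan (m + m') (n + n') :=
  @Cospan (m + m') (n + n') (apex c + apex d)%type
    (tens_leg (lin c) (lin d)) (tens_leg (lout c) (lout d)).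

Definition swap_ord m n (i : 'I_(n + m)) : 'I_(m + n) :=
  match split i with inl j => rshift m j | inr j => lshift n j end.

Definition cospan_sym m n : cospan (m + n) (n + m) :=
  @Cospan (m + n) (n + m) 'I_(m + n) id (@swap_ord m n).

Definition sum_map (A B A' B' : Type) (f : A -> A') (g : B -> B') (u : A + B) :
    A' + B' :=
  match u with inl a => inl (f a) | inr b => inr (g b) end.

Record circuit (L : Type) (m n : nat) := Circuit {
  circuit_cospan :> cospan m n;
  edge : finType;
  src : edge -> apex circuit_cospan;
  tgt : edge -> apex circuit_cospan;
  lab : edge -> L }.

Definition circuit_iso L m n (c d : circuit L m n) : Prop :=
  exists (f : apex c -> apex d) (g : edge c -> edge d),
    [/\ bijective f, forall i, f (lin c i) = lin d i &
        forall j, f (lout c j) = lout d j] /\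
    [/\ bijective g, forall e, f (src e) = src (g e),
        forall e, f (tgt e) = tgt (g e) & forall e, lab e = lab (g e)].

Definition circuit_of_cospan L m n (c : cospan m n) : circuit L m n :=
  @Circuit L m n c void (of_void _) (of_void _) (of_void _).

Definition circuit_comp L m n p (c : circuit L m n) (d : circuit L n p) :
    circuit L m p :=
  @Circuit L m p (cospan_comp c d) (edge c + edge d)%type
    (fun e => match e with inl e => po_l (src e) | inr e => po_r (src e) end)
    (fun e => match e with inl e => po_l (tgt e) | inr e => po_r (tgt e) end)
    (fun e => match e with inl e => lab e | inr e => lab e end).

Definition circuit_tens L m n m' n' (c : circuit L m n) (d : circuit L m' n') :
    circuit L (m + m') (n + n') :=
  @Circuit L (m + m') (n + n') (cospan_tens c d) (edge c + edge d)%type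
    (sum_map (@src _ _ _ c) (@src _ _ _ d))
    (sum_map (@tgt _ _ _ c) (@tgt _ _ _ d))
    (fun e => match e with inl e => lab e | inr e => lab e end).

(* false is the input node and true the output node.                          *)
Definition circuit_edge L (Z : L) : circuit L 1 1 :=
  @Circuit L 1 1 (@Cospan 1 1 bool (fun=> false) (fun=> true))
    unit (fun=> false) (fun=> true) (fun=> Z).

Lemma tens_leg_l m n (A B : Type) (f : 'I_m -> A) (g : 'I_n -> B) i :
  tens_leg f g (lshift n i) = inl (f i).
Proof. by rewrite /tens_leg -[lshift n i]/(unsplit (inl i)) unsplitK. Qed.

Lemma tens_leg_r m n (A B : Type) (f : 'I_m -> A) (g : 'I_n -> B) i :
  tens_leg f g (rshift m i) = inr (g i).
Proof. by rewrite /tens_leg -[rshift m i]/(unsplit (inr i)) unsplitK. Qed.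

Lemma swap_ord_l m n (i : 'I_n) : swap_ord (lshift m i) = rshift m i.
Proof. by rewrite /swap_ord -[lshift m i]/(unsplit (inl i)) unsplitK. Qed.

Lemma swap_ord_r m n (i : 'I_m) : swap_ord (rshift n i) = lshift n i.
Proof. by rewrite /swap_ord -[rshift n i]/(unsplit (inr i)) unsplitK. Qed.

Lemma swap_ordK m n : cancel (@swap_ord m n) (@swap_ord n m).
Proof.
by move=> i; case: (split_ordP i) => j ->; rewrite !(swap_ord_l, swap_ord_r).
Qed.

Lemma cospan_eqv m n : equivalence (@cospan_iso m n).
Proof.
split.
- by move=> c; exists id; split=> //; exists id.
- move=> c d [f [[f' fK f'K] f1 f2]]; exists f'; split.
  + by exists f.
  + by move=> i; rewrite -f1 fK.
  + by move=> i; rewrite -f2 fK.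
- move=> c d e [f [fb f1 f2]] [g [gb g1 g2]]; exists (g \o f); split.
  + exact: bij_comp.
  + by move=> i; rewrite -g1 -f1.
  + by move=> i; rewrite -g2 -f2.
Qed.

Lemma circuit_eqv L m n : equivalence (@circuit_iso L m n).
Proof.
split.
- by move=> c; exists id, id; split; split=> //; exists id.
- move=> c d [f [g [[[f' fK f'K] f1 f2] [[g' gK g'K] g1 g2 g3]]]]; exists f', g'.
  split; split.
  + by exists f.
  + by move=> i; rewrite -f1 fK.
  + by move=> i; rewrite -f2 fK.
  + by exists g.
  + by move=> e; apply: (can_inj fK); rewrite f'K g1 g'K.
  + by move=> e; apply: (can_inj fK); rewrite f'K g2 g'K.
  + by move=> e; rewrite g3 g'K.
- move=> c d e [f [g [[f1 f2 f3] [g1 g2 g3 g4]]]].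
  move=> [h [k [[h1 h2 h3] [k1 k2 k3 k4]]]]; exists (h \o f), (k \o g).
  split; split=> /=.
  + exact: bij_comp.
  + by move=> i; rewrite f2 h2.
  + by move=> i; rewrite f3 h3.
  + exact: bij_comp.
  + by move=> i; rewrite g2 k2.
  + by move=> i; rewrite g3 k3.
  + by move=> i; rewrite g4 k4.
Qed.

Lemma circuit_isoI L m n (c d : circuit L m n)
    (f : apex c -> apex d) (f' : apex d -> apex c)
    (g : edge c -> edge d) (g' : edge d -> edge c) :
  cancel f f' -> cancel f' f -> cancel g g' -> cancel g' g ->
  (forall i, f (lin c i) = lin d i) -> (forall i, f (lout c i) = lout d i) ->
  (forall e, f (src e) = src (g e)) -> (forall e, f (tgt e) = tgt (g e)) ->
  (forall e, lab e = lab (g e)) -> circuit_iso c d.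
Proof. by move=> *; exists f, g; split; split=> //; [exists f' | exists g']. Qed.

Lemma circuit_comp_iso L m n p (c c' : circuit L m n) (d d' : circuit L n p) :
  circuit_iso c c' -> circuit_iso d d' ->
  circuit_iso (circuit_comp c d) (circuit_comp c' d').
Proof.
move=> [f [g [[[f' fK f'K] f1 f2] [[g' gK g'K] g1 g2 g3]]]].
move=> [h [k [[[h' hK h'K] h1 h2] [[k' kK k'K] k1 k2 k3]]]].
have e1 a : po_l (f (lout c a)) = po_r (h (lin d a)) :> apex (cospan_comp c' d').
  by rewrite f2 h1 po_glue.
have e2 a : po_l (f' (lout c' a)) = po_r (h' (lin d' a)) :> apex (cospan_comp c d).
  by rewrite -f2 -h1 fK hK po_glue.
pose F : apex (cospan_comp c d) -> apex (cospan_comp c' d') :=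
  po_desc (po_l \o f) (po_r \o h).
pose F' : apex (cospan_comp c' d') -> apex (cospan_comp c d) :=
  po_desc (po_l \o f') (po_r \o h').
have Fl x : F (po_l x) = po_l (f x) by rewrite /F po_desc_l.
have Fr x : F (po_r x) = po_r (h x) by rewrite /F po_desc_r.
have F'l x : F' (po_l x) = po_l (f' x) by rewrite /F' po_desc_l.
have F'r x : F' (po_r x) = po_r (h' x) by rewrite /F' po_desc_r.
apply: (@circuit_isoI _ _ _ (circuit_comp c d) (circuit_comp c' d') F F'
  (sum_map g k)
  (sum_map g' k')).
- by move=> x; case: (poP x) => y; rewrite ?(Fl, Fr) ?(F'l, F'r) ?fK ?hK.
- by move=> x; case: (poP x) => y; rewrite ?(F'l, F'r) ?(Fl, Fr) ?f'K ?h'K.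
- by case=> e /=; rewrite ?gK ?kK.
- by case=> e /=; rewrite ?g'K ?k'K.
- by move=> i /=; rewrite Fl -f1.
- by move=> i /=; rewrite Fr -h2.
- by case=> e /=; rewrite ?Fl ?Fr ?g1 ?k1.
- by case=> e /=; rewrite ?Fl ?Fr ?g2 ?k2.
- by case=> e /=; [exact: g3|exact: k3].
Qed.

Lemma circuit_tens_iso L m n m' n' (c c' : circuit L m n) (d d' : circuit L m' n') :
  circuit_iso c c' -> circuit_iso d d' ->
  circuit_iso (circuit_tens c d) (circuit_tens c' d').
Proof.
move=> [f [g [[[f' fK f'K] f1 f2] [[g' gK g'K] g1 g2 g3]]]].
move=> [h [k [[[h' hK h'K] h1 h2] [[k' kK k'K] k1 k2 k3]]]].
apply: (@circuit_isoI _ _ _ (circuit_tens c d) (circuit_tens c' d')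
  (sum_map f h)
  (sum_map f' h')
  (sum_map g k)
  (sum_map g' k')).
- by case=> e /=; rewrite ?fK ?hK.
- by case=> e /=; rewrite ?f'K ?h'K.
- by case=> e /=; rewrite ?gK ?kK.
- by case=> e /=; rewrite ?g'K ?k'K.
- move=> i /=; case: (split_ordP i) => j ->.
    by rewrite !tens_leg_l -f1.
  by rewrite !tens_leg_r -h1.
- move=> i /=; case: (split_ordP i) => j ->.
    by rewrite !tens_leg_l -f2.
  by rewrite !tens_leg_r -h2.
- by case=> e /=; rewrite ?g1 ?k1.
- by case=> e /=; rewrite ?g2 ?k2.
- by case=> e /=; [exact: g3|exact: k3].
Qed.

Definition Circ_ops (L : Type) : prop_ops := {|
  hom m n := quot (@circuit_iso L m n);
  idm m := cls _ (circuit_of_cospan L (cospan_id m));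
  compm m n p f g := cls _ (circuit_comp (qrepr f) (qrepr g));
  tensm m n m' n' f g := cls _ (circuit_tens (qrepr f) (qrepr g));
  symm m n := cls _ (circuit_of_cospan L (cospan_sym m n)) |}.

Definition circuit_class L m n (c : circuit L m n) : hom (Circ_ops L) m n := cls _ c.

Lemma circP L m n (c d : circuit L m n) :
  circuit_class c = circuit_class d <-> circuit_iso c d.
Proof. exact: (clsP (circuit_eqv L m n)). Qed.

Lemma circ_comp L m n p (c : circuit L m n) (d : circuit L n p) :
  compm (circuit_class c) (circuit_class d) = circuit_class (circuit_comp c d).
Proof. by apply/circP/circuit_comp_iso; apply: repr_cls (circuit_eqv _ _ _) _. Qed.

Lemma circ_tens L m n m' n' (c : circuit L m n) (d : circuit L m' n') :
  tensm (circuit_class c) (circuit_class d) = circuit_class (circuit_tens c d).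
Proof. by apply/circP/circuit_tens_iso; apply: repr_cls (circuit_eqv _ _ _) _. Qed.

Lemma circ_surj L m n (f : hom (Circ_ops L) m n) : exists c, f = circuit_class c.
Proof. by exists (qrepr f); rewrite /circuit_class reprK. Qed.

Section CircLaws.
Variable L : Type.
Implicit Types m n p q : nat.

Definition relab m n m' n' (c : circuit L m n) (i : 'I_m' -> apex c)
    (o : 'I_n' -> apex c) : circuit L m' n' :=
  @Circuit L m' n' (Cospan i o) (edge c)
    (@src _ _ _ c) (@tgt _ _ _ c) (@lab _ _ _ c).

Lemma relab_id m n (c : circuit L m n) : circuit_class (relab (lin c) (lout c)) = circuit_class c.
Proof.
by apply/circP; apply: (@circuit_isoI _ _ _ (relab (lin c) (lout c)) c id id id id).
Qed.

Definition wires m n (h : 'I_n -> 'I_m) : circuit L m n :=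
  circuit_of_cospan L (@Cospan m n 'I_m id h).

Lemma comp_wires_r m n p (c : circuit L m n) (h : 'I_p -> 'I_n) :
  compm (circuit_class c) (circuit_class (wires h)) = circuit_class (relab (lin c) (lout c \o h)).
Proof.
rewrite circ_comp; apply/circP.
pose F : apex (circuit_comp c (wires h)) -> apex c := po_desc id (lout c).
have Fl x : F (po_l x) = x by rewrite /F po_desc_l.
have Fr x : F (po_r x) = lout c x by rewrite /F po_desc_r.
apply: (@circuit_isoI _ _ _ (circuit_comp c (wires h)) (relab (lin c) (lout c \o h))
  F po_l (fun e => match e with inl e => e | inr e => of_void _ e end) inl).
- by move=> x; case: (poP x) => y; rewrite ?(Fl, Fr) //= (po_glue (lout c)).
- by move=> x; rewrite Fl.
- by case=> // -[].
- by [].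
- by move=> i; exact: Fl.
- by move=> i; exact: Fr.
- by case=> [e|[]]; exact: Fl.
- by case=> [e|[]]; exact: Fl.
- by case=> [e|[]].
Qed.

Lemma comp_wires_l m n p (c : circuit L n p) (h : 'I_n -> 'I_m) (h' : 'I_m -> 'I_n) :
  cancel h h' -> cancel h' h ->
  compm (circuit_class (wires h)) (circuit_class c) = circuit_class (relab (lin c \o h') (lout c)).
Proof.
move=> hK h'K; rewrite circ_comp; apply/circP.
pose F : apex (circuit_comp (wires h) c) -> apex c := po_desc (lin c \o h') id.
have ok a : (lin c \o h') (h a) = id (lin c a) by rewrite /= hK.
have Fl x : F (po_l x) = lin c (h' x) by rewrite /F po_desc_l.
have Fr x : F (po_r x) = x by rewrite /F po_desc_r.
apply: (@circuit_isoI _ _ _ (circuit_comp (wires h) c) (relab (lin c \o h') (lout c))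
  F po_r (fun e => match e with inl e => of_void _ e | inr e => e end) inr).
- move=> x; case: (poP x) => y; rewrite ?(Fl, Fr) //=.
  by rewrite -(po_glue h (lin c)) h'K.
- by move=> x; rewrite Fr.
- by case=> // -[].
- by [].
- by move=> i; exact: Fl.
- by move=> i; exact: Fr.
- by case=> [[]|e]; exact: Fr.
- by case=> [[]|e]; exact: Fr.
- by case=> [[]|e].
Qed.

Definition ord_sum m n m' n' (h : 'I_n -> 'I_m) (h' : 'I_n' -> 'I_m')
  (i : 'I_(n + n')) : 'I_(m + m') := unsplit (tens_leg h h' i).

Lemma comp_wires m n p (h : 'I_n -> 'I_m) (h' : 'I_p -> 'I_n) :
  compm (circuit_class (wires h)) (circuit_class (wires h')) = circuit_class (wires (h \o h')).
Proof. by rewrite comp_wires_r; exact: (relab_id (wires (h \o h'))). Qed.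

Lemma tens_wires m n m' n' (h : 'I_n -> 'I_m) (h' : 'I_n' -> 'I_m') :
  tensm (circuit_class (wires h)) (circuit_class (wires h')) = circuit_class (wires (ord_sum h h')).
Proof.
rewrite circ_tens; apply/circP.
apply: (@circuit_isoI _ _ _ (circuit_tens (wires h) (wires h')) (wires (ord_sum h h'))
  (@unsplit m m') (@split m m')
  (fun e => match e with inl e => e | inr e => e end) inl).
- exact: unsplitK.
- exact: splitK.
- by case=> -[].
- by case.
- by move=> i; case: (split_ordP i) => j -> /=; rewrite (tens_leg_l, tens_leg_r).
- by [].
- by case=> -[].
- by case=> -[].
- by case=> -[].
Qed.

Lemma circ_cast m n m' n' (em : m = m') (en : n = n') (c : circuit L m n) :
  castm em en (circuit_class c) =
  circuit_class (relab (lin c \o cast_ord (esym em)) (lout c \o cast_ord (esym en))).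
Proof.
case: _ / em; case: _ / en; rewrite -[LHS]relab_id.
by congr (circuit_class (relab _ _)); apply: funext => i /=; rewrite cast_ord_id.
Qed.

Lemma wires_cast m n m' n' (em : m = m') (en : n = n') (h : 'I_n -> 'I_m) :
  castm em en (circuit_class (wires h)) =
  circuit_class (wires (cast_ord em \o h \o cast_ord (esym en))).
Proof.
case: _ / em; case: _ / en => /=; congr (circuit_class (wires _)); apply: funext => i /=.
by rewrite !cast_ord_id.
Qed.

Lemma Circ_is_prop : is_prop (Circ_ops L).
Proof.
split.
- move=> m n f; case: (circ_surj f) => {f}c ->.
  by rewrite -[RHS]relab_id; exact: (@comp_wires_l _ _ _ c id id).
- move=> m n f; case: (circ_surj f) => {f}c ->.
  by rewrite -[RHS]relab_id; exact: (@comp_wires_r _ _ _ c id).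
- move=> m n p q f g h.
  case: (circ_surj f) => {f}a ->; case: (circ_surj g) => {g}b ->.
  case: (circ_surj h) => {h}c ->; rewrite !circ_comp; apply/circP.
  pose A := circuit_comp a (circuit_comp b c).
  pose B := circuit_comp (circuit_comp a b) c.
  pose F1 : apex (circuit_comp b c) -> apex B := po_desc (po_l \o po_r) po_r.
  have F1l x : F1 (po_l x) = po_l (po_r x).
    by rewrite /F1 po_desc_l // => y; exact: (po_glue (lout (circuit_comp a b))).
  have F1r x : F1 (po_r x) = po_r x.
    by rewrite /F1 po_desc_r // => y; exact: (po_glue (lout (circuit_comp a b))).
  pose F : apex A -> apex B := po_desc (po_l \o po_l) F1.
  have okF y : (po_l \o po_l) (lout a y) = F1 (lin (circuit_comp b c) y).
    by rewrite /= F1l po_glue.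
  have Fl x : F (po_l x) = po_l (po_l x) by rewrite /F po_desc_l.
  have Fr x : F (po_r x) = F1 x by rewrite /F po_desc_r.
  pose G1 : apex (circuit_comp a b) -> apex A := po_desc po_l (po_r \o po_l).
  have okG1 y : po_l (lout a y) = (po_r \o po_l) (lin b y) :> apex A.
    exact: (po_glue _ (lin (circuit_comp b c))).
  have G1l x : G1 (po_l x) = po_l x by rewrite /G1 po_desc_l.
  have G1r x : G1 (po_r x) = po_r (po_l x) by rewrite /G1 po_desc_r.
  pose G : apex B -> apex A := po_desc G1 (po_r \o po_r).
  have okG y : G1 (lout (circuit_comp a b) y) = (po_r \o po_r) (lin c y).
    by rewrite /= G1r po_glue.
  have Gl x : G (po_l x) = G1 x by rewrite /G po_desc_l.
  have Gr x : G (po_r x) = po_r (po_r x) by rewrite /G po_desc_r.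
  apply: (@circuit_isoI _ _ _ A B F G
    (fun e => match e with inl e => inl (inl e) | inr (inl e) => inl (inr e)
              | inr (inr e) => inr e end)
    (fun e => match e with inr e => inr (inr e) | inl (inr e) => inr (inl e)
              | inl (inl e) => inl e end)).
  + move=> x; case: (poP x) => y; first by rewrite Fl Gl G1l.
    by rewrite Fr; case: (poP y) => z; rewrite (F1l, F1r) ?Gl ?Gr ?G1r.
  + move=> x; case: (poP x) => y; last by rewrite Gr Fr F1r.
    by rewrite Gl; case: (poP y) => z; rewrite (G1l, G1r) ?Fl ?Fr ?F1l.
  + by move=> [|[]].
  + by move=> [[]|].
  + by move=> i; exact: Fl.
  + by move=> i; rewrite /= Fr F1r.
  + by move=> [e|[e|e]] /=; rewrite (Fl, Fr) ?(F1l, F1r).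
  + by move=> [e|[e|e]] /=; rewrite (Fl, Fr) ?(F1l, F1r).
  + by move=> [e|[e|e]].
- move=> m n; rewrite [LHS]tens_wires; congr (circuit_class (wires _)); apply: funext => i.
  by rewrite /ord_sum /=; case: (split_ordP i) => j ->; rewrite (tens_leg_l, tens_leg_r).
- move=> m n p m' n' p' f g f' g'.
  case: (circ_surj f) => {f}a ->; case: (circ_surj g) => {g}b ->.
  case: (circ_surj f') => {f'}c ->; case: (circ_surj g') => {g'}d ->.
  rewrite !(circ_comp, circ_tens); apply/circP.
  pose A := circuit_tens (circuit_comp a b) (circuit_comp c d).
  pose B := circuit_comp (circuit_tens a c) (circuit_tens b d).
  pose F1 : apex (circuit_comp a b) -> apex B := po_desc (po_l \o inl) (po_r \o inl).
  have ok1 y : (po_l \o inl) (lout a y) = (po_r \o inl) (lin b y) :> apex B.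
    have := po_glue (lout (circuit_tens a c)) (lin (circuit_tens b d)) (lshift _ y).
    by rewrite /= !tens_leg_l.
  have F1l x : F1 (po_l x) = po_l (inl x) by rewrite /F1 po_desc_l.
  have F1r x : F1 (po_r x) = po_r (inl x) by rewrite /F1 po_desc_r.
  pose F2 : apex (circuit_comp c d) -> apex B := po_desc (po_l \o inr) (po_r \o inr).
  have ok2 y : (po_l \o inr) (lout c y) = (po_r \o inr) (lin d y) :> apex B.
    have := po_glue (lout (circuit_tens a c)) (lin (circuit_tens b d)) (rshift _ y).
    by rewrite /= !tens_leg_r.
  have F2l x : F2 (po_l x) = po_l (inr x) by rewrite /F2 po_desc_l.
  have F2r x : F2 (po_r x) = po_r (inr x) by rewrite /F2 po_desc_r.
  pose F : apex A -> apex B := fun u => match u with inl x => F1 x | inr x => F2 x end.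
  pose G : apex B -> apex A := po_desc (sum_map po_l po_l) (sum_map po_r po_r).
  have okG y : sum_map po_l po_l (lout (circuit_tens a c) y) =
               sum_map po_r po_r (lin (circuit_tens b d) y) :> apex A.
    case: (split_ordP y) => z -> /=.
      by rewrite !tens_leg_l /= po_glue.
    by rewrite !tens_leg_r /= po_glue.
  have Gl x : G (po_l x) = sum_map po_l po_l x by rewrite /G po_desc_l.
  have Gr x : G (po_r x) = sum_map po_r po_r x by rewrite /G po_desc_r.
  apply: (@circuit_isoI _ _ _ A B F G
    (fun e => match e with inl (inl e) => inl (inl e) | inl (inr e) => inr (inl e)
              | inr (inl e) => inl (inr e) | inr (inr e) => inr (inr e) end)
    (fun e => match e with inl (inl e) => inl (inl e) | inl (inr e) => inr (inl e)
              | inr (inl e) => inl (inr e) | inr (inr e) => inr (inr e) end)).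
  + by case=> x /=; case: (poP x) => y; rewrite (F1l, F1r, F2l, F2r) (Gl, Gr).
  + move=> x; case: (poP x) => y; rewrite (Gl, Gr); case: y => y /=;
    by rewrite (F1l, F1r, F2l, F2r).
  + by move=> [[]|[]].
  + by move=> [[]|[]].
  + by move=> i; case: (split_ordP i) => j -> /=; rewrite !(tens_leg_l, tens_leg_r) /= (F1l, F2l).
  + by move=> i; case: (split_ordP i) => j -> /=; rewrite !(tens_leg_l, tens_leg_r) /= (F1r, F2r).
  + by move=> [[e|e]|[e|e]] /=; rewrite (F1l, F1r, F2l, F2r).
  + by move=> [[e|e]|[e|e]] /=; rewrite (F1l, F1r, F2l, F2r).
  + by move=> [[e|e]|[e|e]].
- move=> m n m' n' m'' n'' f f' f''.
  case: (circ_surj f) => {f}a ->; case: (circ_surj f') => {f'}b ->.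
  case: (circ_surj f'') => {f''}c ->; rewrite !circ_tens circ_cast; apply/circP.
  set A := relab _ _; set B := circuit_tens _ _.
  have leg M N P T1 T2 T3 (f : 'I_M -> T1) (g : 'I_N -> T2) (h : 'I_P -> T3) i :
      match tens_leg f (tens_leg g h) (cast_ord (esym (addnA M N P)) i) with
      | inl x => inl (inl x) | inr (inl x) => inl (inr x) | inr (inr x) => inr x end
      = tens_leg (tens_leg f g) h i.
    case: (split_ordP i) => j ->; last first.
      rewrite tens_leg_r.
      have -> : cast_ord (esym (addnA M N P)) (rshift (M + N) j) = rshift M (rshift N j).
        by apply/val_inj; rewrite /= addnA.
      by rewrite !tens_leg_r.
    case: (split_ordP j) => k ->.
      have -> : cast_ord (esym (addnA M N P)) (lshift P (lshift N k)) = lshift (N + P) k.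
        exact/val_inj.
      by rewrite !tens_leg_l.
    have -> : cast_ord (esym (addnA M N P)) (lshift P (rshift M k)) =
              rshift M (lshift P k) by exact/val_inj.
    by rewrite !tens_leg_l !tens_leg_r tens_leg_l.
  apply: (@circuit_isoI _ _ _ A B
    (fun e => match e with inl e => inl (inl e) | inr (inl e) => inl (inr e)
              | inr (inr e) => inr e end)
    (fun e => match e with inr e => inr (inr e) | inl (inr e) => inr (inl e)
              | inl (inl e) => inl e end)
    (fun e => match e with inl e => inl (inl e) | inr (inl e) => inl (inr e)
              | inr (inr e) => inr e end)
    (fun e => match e with inr e => inr (inr e) | inl (inr e) => inr (inl e)
              | inl (inl e) => inl e end)).
  + by move=> [|[]].
  + by move=> [[]|].
  + by move=> [|[]].
  + by move=> [[]|].
  + by move=> i; exact: leg.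
  + by move=> i; exact: leg.
  + by move=> [e|[e|e]].
  + by move=> [e|[e|e]].
  + by move=> [e|[e|e]].
- move=> m n f; case: (circ_surj f) => {f}c ->; rewrite circ_tens circ_cast; apply/circP.
  set A := relab _ _.
  have leg M T (f : 'I_M -> T) i :
      match tens_leg (id : 'I_0 -> 'I_0) f (cast_ord (esym (add0n M)) i) with
      | inl x => False_rect _ (notF (ltn_ord x)) | inr x => x end = f i.
    have -> : cast_ord (esym (add0n M)) i = rshift 0 i by exact/val_inj.
    by rewrite tens_leg_r.
  apply: (@circuit_isoI _ _ _ A c
    (fun x => match x with inl x => False_rect _ (notF (ltn_ord x)) | inr x => x end) inr
    (fun e => match e with inl e => of_void _ e | inr e => e end) inr) => //.
  + by case=> // -[].
  + by case=> // -[].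
  + by move=> i; exact: leg.
  + by move=> i; exact: leg.
  + by case=> // -[].
  + by case=> // -[].
  + by case=> // -[].
- move=> m n f; case: (circ_surj f) => {f}c ->; rewrite circ_tens circ_cast; apply/circP.
  set A := relab _ _.
  have leg M T (f : 'I_M -> T) i :
      match tens_leg f (id : 'I_0 -> 'I_0) (cast_ord (esym (addn0 M)) i) with
      | inl x => x | inr x => False_rect _ (notF (ltn_ord x)) end = f i.
    have -> : cast_ord (esym (addn0 M)) i = lshift 0 i by exact/val_inj.
    by rewrite tens_leg_l.
  apply: (@circuit_isoI _ _ _ A c
    (fun x => match x with inl x => x | inr x => False_rect _ (notF (ltn_ord x)) end) inl
    (fun e => match e with inl e => e | inr e => of_void _ e end) inl) => //.
  + by case=> // -[].
  + by case=> // -[].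
  + by move=> i; exact: leg.
  + by move=> i; exact: leg.
  + by case=> // -[].
  + by case=> // -[].
  + by case=> // -[].
- move=> m n m' n' f g; case: (circ_surj f) => {f}c ->; case: (circ_surj g) => {g}d ->.
  rewrite !circ_tens [LHS]comp_wires_r.
  rewrite [RHS](comp_wires_l _ (@swap_ordK _ _) (@swap_ordK _ _)); apply/circP.
  set A := relab _ _; set B := relab _ _.
  pose sw X Y (u : X + Y) : Y + X := match u with inl x => inr x | inr x => inl x end.
  apply: (@circuit_isoI _ _ _ A B (@sw _ _) (@sw _ _) (@sw _ _) (@sw _ _)).
  + by case.
  + by case.
  + by case.
  + by case.
  + by move=> i; case: (split_ordP i) => j -> /=;
      rewrite (swap_ord_l, swap_ord_r) !(tens_leg_l, tens_leg_r).
  + by move=> i; case: (split_ordP i) => j -> /=;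
      rewrite (swap_ord_l, swap_ord_r) !(tens_leg_l, tens_leg_r).
  + by case.
  + by case.
  + by case.
- move=> m n; rewrite [LHS]comp_wires; congr (circuit_class (wires _)); apply: funext => i.
  exact: swap_ordK.
- move=> m n p.
  rewrite -[symm m n]/(circuit_class (wires (@swap_ord m n))).
  rewrite -[symm m p]/(circuit_class (wires (@swap_ord m p))).
  rewrite -[idm n]/(circuit_class (wires id)) -[idm p]/(circuit_class (wires id)).
  rewrite !tens_wires !wires_cast comp_wires -[LHS]/(circuit_class (wires (@swap_ord m (n + p)))).
  congr (circuit_class (wires _)); apply: funext => i; apply/val_inj => /=.
  rewrite /ord_sum; case: (split_ordP i) => j ->; last first.
    rewrite swap_ord_r /=.
    have -> : cast_ord (esym (addnA n p m)) (rshift (n + p) j) = rshift n (rshift p j).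
      by apply/val_inj; rewrite /= addnA.
    rewrite tens_leg_r swap_ord_r /=.
    have -> : cast_ord (esym (esym (addnA n m p))) (cast_ord erefl (rshift n (lshift p j)))
        = lshift p (rshift n j) by exact/val_inj.
    by rewrite tens_leg_l /= swap_ord_r.
  case: (split_ordP j) => k ->; rewrite swap_ord_l /=.
    have -> : cast_ord (esym (addnA n p m)) (lshift m (lshift p k)) = lshift (p + m) k.
      exact/val_inj.
    rewrite tens_leg_l /=.
    have -> : cast_ord (esym (esym (addnA n m p))) (cast_ord erefl (lshift (m + p) k))
        = lshift p (lshift m k) by exact/val_inj.
    by rewrite tens_leg_l /= swap_ord_l.
  have -> : cast_ord (esym (addnA n p m)) (lshift m (rshift n k)) = rshift n (lshift m k).
    exact/val_inj.
  rewrite tens_leg_r swap_ord_l /=.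
  have -> : cast_ord (esym (esym (addnA n m p))) (cast_ord erefl (rshift n (rshift m k)))
        = rshift (n + m) k by apply/val_inj; rewrite /= addnA.
  by rewrite tens_leg_r /= addnA.
Qed.
End CircLaws.

Definition Circ (L : Type) : prop := MkProp (Circ_is_prop L).

Definition FinCospan_ops : prop_ops := {|
  hom m n := quot (@cospan_iso m n);
  idm m := cls _ (cospan_id m);
  compm m n p f g := cls _ (cospan_comp (qrepr f) (qrepr g));
  tensm m n m' n' f g := cls _ (cospan_tens (qrepr f) (qrepr g));
  symm m n := cls _ (cospan_sym m n) |}.

Definition cospan_class m n (c : cospan m n) : hom FinCospan_ops m n := cls _ c.

Lemma cospP m n (c d : cospan m n) : cospan_class c = cospan_class d <-> cospan_iso c d.
Proof. exact: (clsP (cospan_eqv m n)). Qed.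

Section CospanInCircuit.
Variable L : Type.

Lemma circuit_of_cospan_iso m n (c d : cospan m n) :
  circuit_iso (circuit_of_cospan L c) (circuit_of_cospan L d) <-> cospan_iso c d.
Proof.
split=> [[f [g [Hf _]]]|[f Hf]]; first by exists f.
by exists f, id; split=> //; split; [exists id | case | case | case].
Qed.

Lemma circuit_of_cospan_comp m n p (c : cospan m n) (d : cospan n p) :
  circuit_iso (circuit_of_cospan L (cospan_comp c d))
    (circuit_comp (circuit_of_cospan L c) (circuit_of_cospan L d)).
Proof.
apply: (@circuit_isoI _ _ _ (circuit_of_cospan L (cospan_comp c d))
  (circuit_comp (circuit_of_cospan L c) (circuit_of_cospan L d))
  id id inl (fun e => match e with inl e => e | inr e => e end)) => //.
all: by case=> // -[].
Qed.

Lemma circuit_of_cospan_tens m n m' n' (c : cospan m n) (d : cospan m' n') :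
  circuit_iso (circuit_of_cospan L (cospan_tens c d))
    (circuit_tens (circuit_of_cospan L c) (circuit_of_cospan L d)).
Proof.
apply: (@circuit_isoI _ _ _ (circuit_of_cospan L (cospan_tens c d))
  (circuit_tens (circuit_of_cospan L c) (circuit_of_cospan L d))
  id id inl (fun e => match e with inl e => e | inr e => e end)) => //.
all: by case=> // -[].
Qed.
End CospanInCircuit.

Lemma cospan_comp_iso m n p (c c' : cospan m n) (d d' : cospan n p) :
  cospan_iso c c' -> cospan_iso d d' ->
  cospan_iso (cospan_comp c d) (cospan_comp c' d').
Proof.
move=> /(circuit_of_cospan_iso unit) hc /(circuit_of_cospan_iso unit) hd.
apply/(circuit_of_cospan_iso unit); case: (circuit_eqv unit m p) => _ S T.
apply: (T _ _ _ (circuit_of_cospan_comp _ _ _)); apply: (T _ _ _ (circuit_comp_iso hc hd)).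
exact/S/circuit_of_cospan_comp.
Qed.

Lemma cospan_tens_iso m n m' n' (c c' : cospan m n) (d d' : cospan m' n') :
  cospan_iso c c' -> cospan_iso d d' ->
  cospan_iso (cospan_tens c d) (cospan_tens c' d').
Proof.
move=> /(circuit_of_cospan_iso unit) hc /(circuit_of_cospan_iso unit) hd.
apply/(circuit_of_cospan_iso unit).
case: (circuit_eqv unit (m + m') (n + n')) => _ S T.
apply: (T _ _ _ (circuit_of_cospan_tens _ _ _)); apply: (T _ _ _ (circuit_tens_iso hc hd)).
exact/S/circuit_of_cospan_tens.
Qed.

Lemma cosp_comp m n p (c : cospan m n) (d : cospan n p) :
  compm (cospan_class c) (cospan_class d) = cospan_class (cospan_comp c d).
Proof. by apply/cospP/cospan_comp_iso; apply: repr_cls (cospan_eqv _ _) _. Qed.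

Lemma cosp_tens m n m' n' (c : cospan m n) (d : cospan m' n') :
  tensm (cospan_class c) (cospan_class d) = cospan_class (cospan_tens c d).
Proof. by apply/cospP/cospan_tens_iso; apply: repr_cls (cospan_eqv _ _) _. Qed.

Lemma cosp_surj m n (f : hom FinCospan_ops m n) : exists c, f = cospan_class c.
Proof. by exists (qrepr f); rewrite /cospan_class reprK. Qed.

Definition cospan_to_circ_fun (L : Type) m n (f : hom FinCospan_ops m n) : hom (Circ L) m n :=
  circuit_class (circuit_of_cospan L (qrepr f)).

Lemma incl_funE L m n (c : cospan m n) :
  cospan_to_circ_fun L (cospan_class c) = circuit_class (circuit_of_cospan L c).
Proof. by apply/circP/circuit_of_cospan_iso; apply: repr_cls (cospan_eqv _ _) _. Qed.

Lemma incl_is_morphism L : @is_prop_morphism FinCospan_ops (Circ L) (@cospan_to_circ_fun L).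
Proof.
split.
- by move=> m; exact: incl_funE.
- move=> m n p f g; case: (cosp_surj f) => {f}c ->; case: (cosp_surj g) => {g}d ->.
  by rewrite cosp_comp !incl_funE circ_comp; apply/circP/circuit_of_cospan_comp.
- move=> m n p q f g; case: (cosp_surj f) => {f}c ->; case: (cosp_surj g) => {g}d ->.
  by rewrite cosp_tens !incl_funE circ_tens; apply/circP/circuit_of_cospan_tens.
- by move=> m n; exact: incl_funE.
Qed.

Lemma incl_inj L m n : injective (@cospan_to_circ_fun L m n).
Proof.
move=> f g; case: (cosp_surj f) => {f}c ->; case: (cosp_surj g) => {g}d ->.
by rewrite !incl_funE => /circP/circuit_of_cospan_iso/cospP.
Qed.

Definition FinCospan : prop :=
  MkProp (is_prop_inj (incl_is_morphism unit) (@incl_inj unit)).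

Definition cospan_to_circ (L : Type) : prop_morphism FinCospan (Circ L) :=
  @PropMorphism FinCospan (Circ L) (@cospan_to_circ_fun L) (incl_is_morphism L).

Definition jointly_epic m n (c : cospan m n) : Prop :=
  forall (T : finType) (g h : apex c -> T),
    (forall i, g (lin c i) = h (lin c i)) ->
    (forall j, g (lout c j) = h (lout c j)) -> g =1 h.

Definition joint_image m n (c : cospan m n) : pred (apex c) := fun x =>
  [exists i, lin c i == x] || [exists j, lout c j == x].

Lemma joint_lin m n (c : cospan m n) i : joint_image (lin c i).
Proof. by apply/orP; left; apply/existsP; exists i. Qed.

Lemma joint_lout m n (c : cospan m n) j : joint_image (lout c j).
Proof. by apply/orP; right; apply/existsP; exists j. Qed.

Lemma jointP m n (c : cospan m n) x :
  joint_image x -> (exists i, x = lin c i) \/ (exists j, x = lout c j).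
Proof.
by case/orP=> /existsP[i /eqP <-]; [left|right]; exists i.
Qed.

Lemma jointly_epicP m n (c : cospan m n) :
  jointly_epic c <-> forall x : apex c, joint_image x.
Proof.
split=> [epi x | sur T g h gh1 gh2 x].
  by apply: (epi bool (@joint_image m n c) xpredT) => i; rewrite (joint_lin, joint_lout).
by case: (jointP (sur x)) => -[i ->].
Qed.

(* Restriction of the apex to the joint image of the legs.                    *)
Definition restrict m n (c : cospan m n) : cospan m n :=
  @Cospan m n {x : apex c | joint_image x}
    (fun i => exist _ (lin c i) (joint_lin c i))
    (fun j => exist _ (lout c j) (joint_lout c j)).

Lemma restrict_epic m n (c : cospan m n) : jointly_epic (restrict c).
Proof.
apply/jointly_epicP => x; case: (jointP (valP x)) => -[i Hi].
  have -> : x = lin (restrict c) i by apply/val_inj.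
  exact: joint_lin.
have -> : x = lout (restrict c) i by apply/val_inj.
exact: joint_lout.
Qed.

Lemma id_epic m : jointly_epic (cospan_id m).
Proof. by move=> T g h gh _ x; exact: gh. Qed.

Lemma sym_epic m n : jointly_epic (cospan_sym m n).
Proof. by move=> T g h gh _ x; exact: gh. Qed.

Lemma tens_epic m n m' n' (c : cospan m n) (d : cospan m' n') :
  jointly_epic c -> jointly_epic d -> jointly_epic (cospan_tens c d).
Proof.
move=> epi_c epi_d T g h gh1 gh2 [x|x].
  apply: (epi_c T (g \o inl) (h \o inl)) => i /=.
    by have := gh1 (lshift _ i); rewrite /= tens_leg_l.
  by have := gh2 (lshift _ i); rewrite /= tens_leg_l.
apply: (epi_d T (g \o inr) (h \o inr)) => i /=.
  by have := gh1 (rshift _ i); rewrite /= tens_leg_r.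
by have := gh2 (rshift _ i); rewrite /= tens_leg_r.
Qed.

Definition corel m n := {c : cospan m n | jointly_epic c}.

Definition corel_iso m n (c d : corel m n) : Prop := cospan_iso (sval c) (sval d).

Definition corel_restrict m n (c : cospan m n) : corel m n :=
  exist _ (restrict c) (@restrict_epic _ _ c).

Definition corel_id m : corel m m := exist _ (cospan_id m) (@id_epic m).

Definition corel_comp m n p (c : corel m n) (d : corel n p) : corel m p :=
  corel_restrict (cospan_comp (sval c) (sval d)).

Definition corel_tens m n m' n' (c : corel m n) (d : corel m' n') :
    corel (m + m') (n + n') :=
  exist _ (cospan_tens (sval c) (sval d)) (@tens_epic _ _ _ _ _ _ (svalP c) (svalP d)).

Definition corel_sym m n : corel (m + n) (n + m) :=
  exist _ (cospan_sym m n) (@sym_epic m n).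

Definition FinCorel_ops : prop_ops := {|
  hom m n := quot (@corel_iso m n);
  idm m := cls _ (corel_id m);
  compm m n p f g := cls _ (corel_comp (qrepr f) (qrepr g));
  tensm m n m' n' f g := cls _ (corel_tens (qrepr f) (qrepr g));
  symm m n := cls _ (corel_sym m n) |}.

Definition corel_class m n (c : corel m n) : hom FinCorel_ops m n := cls _ c.

Lemma corel_eqv m n : equivalence (@corel_iso m n).
Proof.
case: (cospan_eqv m n) => r s t; split.
- by move=> x; exact: r.
- by move=> x y; exact: s.
- by move=> x y z; exact: t.
Qed.

Lemma corlP m n (c d : corel m n) : corel_class c = corel_class d <-> corel_iso c d.
Proof. exact: (clsP (corel_eqv m n)). Qed.

Lemma corl_surj m n (f : hom FinCorel_ops m n) : exists c, f = corel_class c.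
Proof. by exists (qrepr f); rewrite /corel_class reprK. Qed.

Lemma restrict_inj_iso m n (c d : cospan m n) (f : apex c -> apex d) :
  injective f -> (forall i, f (lin c i) = lin d i) ->
  (forall j, f (lout c j) = lout d j) -> cospan_iso (restrict c) (restrict d).
Proof.
move=> f_inj f1 f2.
have fim (x : apex c) : joint_image x -> joint_image (f x).
  by case/jointP=> -[i ->]; rewrite (f1, f2) (joint_lin, joint_lout).
have fim' (x : apex c) : joint_image (f x) -> joint_image x.
  by case/jointP=> -[i]; rewrite -?f1 -?f2 => /f_inj ->; rewrite (joint_lin, joint_lout).
pose F (x : apex (restrict c)) : apex (restrict d) := exist _ (f (val x)) (fim _ (valP x)).
exists F; split=> [|i|i]; try by apply/val_inj; rewrite /= (f1, f2).
apply: inj_card_bij => [x y /(congr1 val) /f_inj/val_inj //|].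
rewrite -(card_codom (f := F)); last by move=> x y /(congr1 val) /f_inj/val_inj.
apply: subset_leq_card; apply/subsetP => y _.
have /jointP[] := valP y => -[i Hi]; apply/codomP.
  by exists (lin (restrict c) i); apply/val_inj; rewrite Hi /= f1.
by exists (lout (restrict c) i); apply/val_inj; rewrite Hi /= f2.
Qed.

Lemma restrict_id m n (c : cospan m n) : jointly_epic c -> cospan_iso (restrict c) c.
Proof.
move/jointly_epicP => sur.
exists val; split=> //; exists (fun x => exist _ x (sur x)) => // x.
exact/val_inj.
Qed.

Lemma restrict_iso m n (c d : cospan m n) :
  cospan_iso c d -> cospan_iso (restrict c) (restrict d).
Proof. by case=> f [/bij_inj finj f1 f2]; exact: restrict_inj_iso finj f1 f2. Qed.

Lemma restrict_comp m n p (c : cospan m n) (d : cospan n p) :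
  cospan_iso (restrict (cospan_comp (restrict c) (restrict d)))
             (restrict (cospan_comp c d)).
Proof.
pose A := cospan_comp (restrict c) (restrict d); pose B := cospan_comp c d.
pose F : apex A -> apex B := po_desc (po_l \o val) (po_r \o val).
have ok y : (po_l \o val) (lout (restrict c) y) = (po_r \o val) (lin (restrict d) y)
    :> apex B by exact: po_glue.
have Fl x : F (po_l x) = po_l (val x) by rewrite /F po_desc_l.
have Fr x : F (po_r x) = po_r (val x) by rewrite /F po_desc_r.
pose G : apex B -> option (apex A) :=
  po_desc (fun x => omap po_l (insub x)) (fun x => omap po_r (insub x)).
have okG y : omap po_l (insub (lout c y)) = omap po_r (insub (lin d y)) :> option (apex A).
  rewrite (insubT (@joint_image _ _ c) (joint_lout c y)).
  rewrite (insubT (@joint_image _ _ d) (joint_lin d y)) /=; congr Some.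
  have := po_glue (lout (restrict c)) (lin (restrict d)) y.
  by congr (po_l _ = po_r _); apply/val_inj.
have Gl x : G (po_l x) = omap po_l (insub x) by rewrite /G po_desc_l.
have Gr x : G (po_r x) = omap po_r (insub x) by rewrite /G po_desc_r.
apply: (restrict_inj_iso (f := F)) => [|i|j]; [|exact: Fl|exact: Fr].
apply: (@pcan_inj _ _ F G) => x.
by case: (poP x) => y; rewrite (Fl, Fr) (Gl, Gr) valK.
Qed.

Lemma restrict_tens m n m' n' (c : cospan m n) (d : cospan m' n') :
  cospan_iso (restrict (cospan_tens c d)) (cospan_tens (restrict c) (restrict d)).
Proof.
case: (cospan_eqv (m + m') (n + n')) => _ S T; refine (S _ _ _).
have epi := @tens_epic _ _ _ _ _ _ (@restrict_epic _ _ c) (@restrict_epic _ _ d).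
apply: (T _ _ _ (S _ _ (restrict_id epi))).
apply: (restrict_inj_iso (c := cospan_tens (restrict c) (restrict d))
  (d := cospan_tens c d) (f := sum_map val val)).
- by case=> x [] y // [] /val_inj ->.
- by move=> i; case: (split_ordP i) => j -> /=; rewrite !(tens_leg_l, tens_leg_r).
- by move=> i; case: (split_ordP i) => j -> /=; rewrite !(tens_leg_l, tens_leg_r).
Qed.

Lemma corl_comp m n p (c : corel m n) (d : corel n p) :
  compm (corel_class c) (corel_class d) = corel_class (corel_comp c d).
Proof.
by apply/corlP/restrict_iso/cospan_comp_iso; apply: repr_cls (corel_eqv _ _) _.
Qed.

Lemma corl_tens m n m' n' (c : corel m n) (d : corel m' n') :
  tensm (corel_class c) (corel_class d) = corel_class (corel_tens c d).
Proof. by apply/corlP/cospan_tens_iso; apply: repr_cls (corel_eqv _ _) _. Qed.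

Definition H_fun m n (f : hom FinCospan m n) : hom FinCorel_ops m n :=
  corel_class (corel_restrict (qrepr f)).

Lemma H_funE m n (c : cospan m n) : H_fun (cospan_class c) = corel_class (corel_restrict c).
Proof. by apply/corlP/restrict_iso; apply: repr_cls (cospan_eqv _ _) _. Qed.

Lemma H_is_morphism : @is_prop_morphism FinCospan FinCorel_ops H_fun.
Proof.
split.
- by move=> m; rewrite [LHS]H_funE; apply/corlP/restrict_id/id_epic.
- move=> m n p f g; case: (cosp_surj f) => {f}c ->; case: (cosp_surj g) => {g}d ->.
  rewrite [compm _ _]cosp_comp !H_funE corl_comp; apply/corlP.
  by case: (corel_eqv m p) => _ S _; apply/S/restrict_comp.
- move=> m n p q f g; case: (cosp_surj f) => {f}c ->; case: (cosp_surj g) => {g}d ->.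
  by rewrite [tensm _ _]cosp_tens !H_funE corl_tens; apply/corlP/restrict_tens.
- by move=> m n; rewrite [LHS]H_funE; apply/corlP/restrict_id/sym_epic.
Qed.

Lemma H_corel m n (c : corel m n) : H_fun (cospan_class (sval c)) = corel_class c.
Proof. by rewrite H_funE; apply/corlP/restrict_id/(svalP c). Qed.

Lemma H_surj m n (g : hom FinCorel_ops m n) : exists f, H_fun f = g.
Proof.
by case: (corl_surj g) => {g}c ->; exists (cospan_class (sval c)); exact: H_corel.
Qed.

Definition FinCorel : prop := MkProp (is_prop_surj H_is_morphism H_surj).

Definition H : prop_morphism FinCospan FinCorel :=
  @PropMorphism FinCospan FinCorel H_fun H_is_morphism.

Lemma onepart_epic m n : 0 < m + n ->
  jointly_epic (@Cospan m n unit (fun=> tt) (fun=> tt)).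
Proof.
case: m n => [|m] [|n] //= _ T g h gh1 gh2 [].
- exact: gh2 ord0.
- exact: gh1 ord0.
- exact: gh1 ord0.
Qed.

Definition one_part m n (mn : 0 < m + n) : hom FinCorel m n :=
  corel_class (exist _ _ (@onepart_epic m n mn)).

Local Open Scope ring_scope.

(* {x | P x} as an element of {vspace V}; meaningful when P is linear, see    *)
(* mem_subspace.                                                              *)
Definition subspace (k : fieldType) (V : vectType k) (P : V -> Prop) : {vspace V} :=
  if pselect (exists U : {vspace V}, forall v, v \in U <-> P v) is left h
  then sval (cid h) else 0%VS.

Definition linear_pred (k : fieldType) (V : vectType k) (P : V -> Prop) : Prop :=
  P 0 /\ forall a u v, P u -> P v -> P (a *: u + v).

Lemma mem_subspace (k : fieldType) (V : vectType k) (P : V -> Prop) :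
  linear_pred P -> forall v, v \in subspace P <-> P v.
Proof.
move=> [P0 PL]; rewrite /subspace; case: pselect => [h|[]]; first by case: cid.
pose D d := `[< exists2 U : {vspace V}, forall v, v \in U -> P v & \dim U = d >].
have ex : exists d, D d.
  exists 0%N; apply/asboolP; exists 0%VS; last exact: dimv0.
  by move=> v; rewrite memv0 => /eqP ->.
have ub d : D d -> (d <= \dim {:V})%N.
  by move=> /asboolP[U _ <-]; apply/dimvS/subvf.
case: (ex_maxnP ex ub) => d /asboolP[U UP dU] dmax; exists U => v; split; first exact: UP.
move=> Pv; have /dmax : D (\dim (U + <[v]>)%VS).
  apply/asboolP; exists (U + <[v]>)%VS => // w /memv_addP[u uU [x /vlineP[a ->] ->]].
  by rewrite addrC; apply: PL => //; exact: UP.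
rewrite -dU => le; have /eqP -> : U == (U + <[v]>)%VS by rewrite eqEdim addvSl.
by apply: (subvP (addvSr _ _)); exact: memv_line.
Qed.

Record symplectic (k : fieldType) (V : vectType k) (w : V -> V -> k) : Prop :=
  Symplectic {
  form_linl : forall a u u' v, w (a *: u + u') v = a * w u v + w u' v;
  form_linr : forall a u v v', w u (a *: v + v') = a * w u v + w u v';
  form_alt : forall u, w u u = 0;
  form_nondeg : forall u, (forall v, w u v = 0) -> u = 0 }.

Definition isotropic (k : fieldType) (V : vectType k) (w : V -> V -> k)
    (L : {vspace V}) : Prop :=
  forall u v, u \in L -> v \in L -> w u v = 0.

Definition lagrangian (k : fieldType) (V : vectType k) (w : V -> V -> k)
    (L : {vspace V}) : Prop :=
  isotropic w L /\
  forall M : {vspace V}, isotropic w M -> (L <= M)%VS -> M = L.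

Definition form_conj (k : fieldType) (V : vectType k) (w : V -> V -> k) :
  V -> V -> k := fun u v => - w u v.

Definition form_sum (k : fieldType) (V W : vectType k)
    (w : V -> V -> k) (w' : W -> W -> k) : (V * W)%type -> (V * W)%type -> k :=
  fun u v => w u.1 v.1 + w' u.2 v.2.

Section SymplecticTheory.
Variable k : fieldType.
Implicit Types V W U : vectType k.

Lemma symplectic_conj V (w : V -> V -> k) : symplectic w -> symplectic (form_conj w).
Proof.
case=> l r a n; rewrite /form_conj; split=> [c u u' v|c u v v'|u|u h].
- by rewrite l opprD mulrN.
- by rewrite r opprD mulrN.
- by rewrite a oppr0.
- by apply: n => v; apply/eqP; rewrite -oppr_eq0 h.
Qed.

Section OneForm.
Variables (V : vectType k) (w : V -> V -> k).
Hypothesis sw : symplectic w.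

Lemma form0l v : w 0 v = 0.
Proof. by have := form_linl sw (-1) 0 0 v; rewrite scaler0 addr0 mulN1r addNr. Qed.
Lemma form0r v : w v 0 = 0.
Proof. by have := form_linr sw (-1) v 0 0; rewrite scaler0 addr0 mulN1r addNr. Qed.
Lemma formDl u u' v : w (u + u') v = w u v + w u' v.
Proof. by have := form_linl sw 1 u u' v; rewrite scale1r mul1r. Qed.
Lemma formDr u v v' : w u (v + v') = w u v + w u v'.
Proof. by have := form_linr sw 1 u v v'; rewrite scale1r mul1r. Qed.
Lemma formZl a u v : w (a *: u) v = a * w u v.
Proof. by have := form_linl sw a u 0 v; rewrite addr0 form0l addr0. Qed.
Lemma formZr a u v : w u (a *: v) = a * w u v.
Proof. by have := form_linr sw a u v 0; rewrite addr0 form0r addr0. Qed.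
Lemma formNr u v : w u (- v) = - w u v.
Proof. by rewrite -scaleN1r formZr mulN1r. Qed.
Lemma form_skew u v : w v u = - w u v.
Proof.
have := form_alt sw (u + v); rewrite formDl !formDr !(form_alt sw) add0r addr0.
by move=> /eqP; rewrite addrC addr_eq0 => /eqP.
Qed.

Lemma lagrangianP (L : {vspace V}) :
  lagrangian w L <->
  isotropic w L /\ forall v, (forall u, u \in L -> w u v = 0) -> v \in L.
Proof.
split=> [[iso mx]|[iso mx]]; split=> //.
- move=> v vL; rewrite -(mx (L + <[v]>)%VS); last exact: addvSl.
    by apply: (subvP (addvSr _ _)); exact: memv_line.
  move=> x y /memv_addP[u uL [z /vlineP[a ->] ->]] {x z}.
  move=> /memv_addP[u' u'L [z /vlineP[b ->] ->]] {y z}.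
  rewrite !(formDl, formDr) !(formZl, formZr) (form_alt sw) iso // vL //.
  by rewrite form_skew vL // oppr0 !mulr0 !addr0.
- move=> M isoM LM; apply/eqP; rewrite eqEsubv LM andbT; apply/subvP => v vM.
  by apply: mx => u uL; apply: isoM => //; exact: (subvP LM).
Qed.

Lemma form_represents (f : V -> k) :
  (forall a u v, f (a *: u + v) = a * f u + f v) ->
  exists u, forall v, f v = w u v.
Proof.
move=> f_lin.
pose mk (g : V -> k^o) (gl : linear g) : {linear V -> k^o} :=
  HB.pack g (GRing.isLinear.Build _ _ _ _ g gl).
have w_lin u : linear (w u : V -> k^o) by move=> a x y; rewrite (form_linr sw).
pose phi (u : V) : 'Hom(V, k^o) := linfun (mk _ (w_lin u)).
have phiE u v : phi u v = w u v by rewrite lfunE.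
have phi_lin : linear phi.
  move=> a x y; apply/lfunP => v.
  by rewrite add_lfunE scale_lfunE !phiE (form_linl sw).
pose Phi' : {linear V -> 'Hom(V, k^o)} :=
  HB.pack phi (GRing.isLinear.Build _ _ _ _ phi phi_lin).
pose Phi := linfun Phi'.
have PhiE u : Phi u = phi u by rewrite lfunE.
have ker0 : lker Phi == 0%VS.
  apply/lker0P => u v; rewrite !PhiE => e; apply/eqP; rewrite -subr_eq0; apply/eqP.
  apply: (form_nondeg sw) => x; rewrite formDl -[- v]scaleN1r formZl -!phiE e mulN1r.
  by rewrite subrr.
have full : limg Phi = fullv.
  apply/eqP; rewrite eqEdim subvf /= limg_dim_eq; last by rewrite (eqP ker0) capv0.
  by rewrite !dimvf /dim /= muln1.
have : linfun (mk f f_lin) \in limg Phi by rewrite full memvf.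
case/memv_imgP => u _ e; exists u => v.
by rewrite -phiE -PhiE -e lfunE.
Qed.
End OneForm.

Lemma symplectic_sum V W (w : V -> V -> k) (w' : W -> W -> k) :
  symplectic w -> symplectic w' -> symplectic (form_sum w w').
Proof.
move=> sw sw'; rewrite /form_sum; split=> [c u u' v|c u v v'|u|[u u'] h] /=.
- by rewrite (form_linl sw) (form_linl sw') mulrDr addrACA.
- by rewrite (form_linr sw) (form_linr sw') mulrDr addrACA.
- by rewrite (form_alt sw) (form_alt sw') addr0.
- congr pair; [apply: (form_nondeg sw) => v|apply: (form_nondeg sw') => v].
    by have := h (v, 0); rewrite /= (form0r sw') addr0.
  by have := h (0, v); rewrite /= (form0r sw) add0r.
Qed.

Definition rel_form V W (w : V -> V -> k) (w' : W -> W -> k) :=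
  form_sum (form_conj w) w'.

Lemma symplectic_rel V W (w : V -> V -> k) (w' : W -> W -> k) :
  symplectic w -> symplectic w' -> symplectic (rel_form w w').
Proof. by move=> sw sw'; apply: symplectic_sum => //; exact: symplectic_conj. Qed.

Lemma lagrangian_eq V (w : V -> V -> k) (L M : {vspace V}) :
  lagrangian w L -> lagrangian w M -> {subset L <= M} -> L = M.
Proof. by move=> [_ mx] [iso _] /subvP LM; rewrite (mx M). Qed.

Definition rel_id V : {vspace V * V} := subspace (fun p => p.1 = p.2).

Definition rel_comp V W U (R : {vspace V * W}) (S : {vspace W * U}) :
    {vspace V * U} :=
  subspace (fun p => exists y, (p.1, y) \in R /\ (y, p.2) \in S).

Lemma mem_rel_id V (x y : V) : (x, y) \in rel_id V <-> x = y.
Proof.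
rewrite mem_subspace //; split=> // a [u1 u2] [v1 v2] /= -> ->.
by [].
Qed.

Lemma mem_rel_comp V W U (R : {vspace V * W}) (S : {vspace W * U}) x z :
  (x, z) \in rel_comp R S <-> exists y, (x, y) \in R /\ (y, z) \in S.
Proof.
rewrite mem_subspace //; split=> [|a [u1 u2] [v1 v2] /= [y [y1 y2]] [y' [y'1 y'2]]].
  by exists 0; split; exact: mem0v.
exists (a *: y + y'); split.
  exact: (rpredD (rpredZ a y1) y'1).
exact: (rpredD (rpredZ a y2) y'2).
Qed.

Lemma lagrangian_id V (w : V -> V -> k) :
  symplectic w -> lagrangian (rel_form w w) (rel_id V).
Proof.
move=> sw; apply/(lagrangianP (symplectic_rel sw sw)); split.
  move=> [u1 u2] [v1 v2] /mem_rel_id -> /mem_rel_id ->.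
  by rewrite /rel_form /form_sum /form_conj /= addNr.
move=> [v1 v2] h; apply/mem_rel_id/eqP; rewrite -subr_eq0; apply/eqP.
apply: (form_nondeg sw) => x; rewrite (form_skew sw).
have := h (x, x) ((mem_rel_id x x).2 erefl).
rewrite /rel_form /form_sum /form_conj /= (formDr sw) (formNr sw) => /eqP.
by rewrite addrC subr_eq0 => /eqP ->; rewrite subrr oppr0.
Qed.

Lemma lagrangian_comp V W U (wV : V -> V -> k) (wW : W -> W -> k) (wU : U -> U -> k)
    (R : {vspace V * W}) (S : {vspace W * U}) :
  symplectic wV -> symplectic wW -> symplectic wU ->
  lagrangian (rel_form wV wW) R -> lagrangian (rel_form wW wU) S ->
  lagrangian (rel_form wV wU) (rel_comp R S).
Proof.
move=> sV sW sU /(lagrangianP (symplectic_rel sV sW))[isoR mxR].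
move=> /(lagrangianP (symplectic_rel sW sU))[isoS mxS].
apply/(lagrangianP (symplectic_rel sV sU)); split.
  move=> [u1 u2] [v1 v2] /mem_rel_comp[y [y1 y2]] /mem_rel_comp[z [z1 z2]].
  have := isoR _ _ y1 z1; have := isoS _ _ y2 z2.
  rewrite /rel_form /form_sum /form_conj /= => /eqP; rewrite addrC subr_eq0 => /eqP ->.
  by [].
move=> [x z] h; apply/mem_rel_comp.
pose T : vectType k := ((V * W) * (W * U))%type.
pose D : {vspace T} := subspace (fun t : T => t.1 \in R /\ t.2 \in S).
have memD t : t \in D <-> t.1 \in R /\ t.2 \in S.
  rewrite mem_subspace //; split=> [|a u v [u1 u2] [v1 v2]].
    by split; exact: mem0v.
  by split; [exact: (rpredD (rpredZ a u1) v1)|exact: (rpredD (rpredZ a u2) v2)].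
pose d (t : T) : W := t.1.2 - t.2.1.
have d_lin : linear d.
  by move=> a u v; rewrite /d /= scalerBr opprD addrACA.
pose dL' : {linear T -> W} := HB.pack d (GRing.isLinear.Build _ _ _ _ d d_lin).
pose dL := (linfun dL' \o projv D)%VF.
have dLE t : t \in D -> dL t = d t by move=> tD; rewrite comp_lfunE projv_id // lfunE.
pose f (t : T) := - wV t.1.1 x + wU t.2.2 z.
have f_lin a u v : f (a *: u + v) = a * f u + f v.
  by rewrite /f /= (form_linl sV) (form_linl sU) opprD mulrDr mulrN addrACA.
have f0 t : t \in D -> d t = 0 -> f t = 0.
  move=> /memD[t1 t2] /eqP; rewrite subr_eq0 => /eqP dt.
  apply: (h (t.1.1, t.2.2)); apply/mem_rel_comp; exists t.1.2; split.
    by rewrite -surjective_pairing.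
  by rewrite dt -surjective_pairing.
pose g (y : W) := f (projv D (dL^-1%VF y)).
have g_lin a u v : g (a *: u + v) = a * g u + g v.
  by rewrite /g !linearP f_lin.
have gd t : t \in D -> g (d t) = f t.
  move=> tD; set t' := projv D (dL^-1%VF (d t)).
  have t'D : t' \in D by exact: memv_proj.
  have dt' : d t' = d t.
    have -> : d t' = dL (dL^-1%VF (d t)) by rewrite comp_lfunE lfunE.
    by rewrite limg_lfunVK // -dLE //; apply: memv_img; exact: memvf.
  have : f (-1 *: t + t') = 0.
    apply: f0; first by rewrite rpredD // rpredZ.
    by rewrite d_lin dt' scaleN1r addNr.
  rewrite f_lin mulN1r => /eqP; rewrite addrC subr_eq0 => /eqP.
  by rewrite /g.
have [y0 gE] := form_represents sW g_lin.
exists y0; split.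
  apply: mxR => -[u1 u2] uR.
  have tD : (((u1, u2), 0) : T) \in D by apply/memD; split=> //; exact: mem0v.
  have := gd _ tD; rewrite gE /d /f /rel_form /form_sum /form_conj /= subr0.
  by rewrite (form0l sU) addr0 (form_skew sW u2) => <-; rewrite addNr.
apply: mxS => -[u1 u2] uS.
have tD : ((0, (u1, u2)) : T) \in D by apply/memD; split=> //; exact: mem0v.
have := gd _ tD; rewrite gE /d /f /rel_form /form_sum /form_conj /= sub0r.
rewrite (form0l sV) oppr0 add0r (formNr sW) (form_skew sW u1) opprK => <-.
by rewrite addNr.
Qed.
End SymplecticTheory.

(* The space (k (+) k)^n; the coordinates of the j-th copy of k (+) k are     *)
(* written phi_j = pot x j and I_j = cur x j.                                 *)
Definition ports (k : fieldType) (n : nat) : vectType k :=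
  {ffun 'I_n -> (k^o * k^o)%type}.

Definition pot (k : fieldType) n (x : ports k n) (j : 'I_n) : k := (x j).1.
Definition cur (k : fieldType) n (x : ports k n) (j : 'I_n) : k := (x j).2.

Definition omega (k : fieldType) n (x y : ports k n) : k :=
  \sum_(j < n) (pot x j * cur y j - pot y j * cur x j).

Definition lpart (k : fieldType) m n (x : ports k (m + n)) : ports k m :=
  [ffun i => x (lshift n i)].
Definition rpart (k : fieldType) m n (x : ports k (m + n)) : ports k n :=
  [ffun i => x (rshift m i)].

Definition rel_tens (k : fieldType) m n m' n'
    (R : {vspace ports k m * ports k n}) (S : {vspace ports k m' * ports k n'}) :
    {vspace ports k (m + m') * ports k (n + n')} :=
  subspace (fun p => (lpart p.1, lpart p.2) \in R /\ (rpart p.1, rpart p.2) \in S).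

Definition rel_sym (k : fieldType) m n :
    {vspace ports k (m + n) * ports k (n + m)} :=
  subspace (fun p => lpart p.1 = rpart p.2 /\ rpart p.1 = lpart p.2).

Definition lag_rel (k : fieldType) (m n : nat) :=
  {R : {vspace ports k m * ports k n} |
    lagrangian (form_sum (form_conj (@omega k m)) (@omega k n)) R}.

Section LagRel.
Variable k : fieldType.
Implicit Types m n p q : nat.

Definition mkports n (v c : 'I_n -> k) : ports k n := [ffun j => (v j, c j)].

Lemma pot_mk n (v c : 'I_n -> k) j : pot (mkports v c) j = v j.
Proof. by rewrite /pot ffunE. Qed.
Lemma cur_mk n (v c : 'I_n -> k) j : cur (mkports v c) j = c j.
Proof. by rewrite /cur ffunE. Qed.
Lemma pot_lin n a (x y : ports k n) j : pot (a *: x + y) j = a * pot x j + pot y j.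
Proof. by rewrite /pot !ffunE. Qed.
Lemma cur_lin n a (x y : ports k n) j : cur (a *: x + y) j = a * cur x j + cur y j.
Proof. by rewrite /cur !ffunE. Qed.
Lemma pot0 n j : pot (0 : ports k n) j = 0.
Proof. by rewrite /pot ffunE. Qed.
Lemma cur0 n j : cur (0 : ports k n) j = 0.
Proof. by rewrite /cur ffunE. Qed.
Lemma ports_eq n (x y : ports k n) :
  (forall j, pot x j = pot y j) -> (forall j, cur x j = cur y j) -> x = y.
Proof.
move=> h1 h2; apply/ffunP => j; rewrite (surjective_pairing (x j)).
by rewrite (surjective_pairing (y j)); congr pair; [exact: h1|exact: h2].
Qed.

Lemma pot_lpart m n (x : ports k (m + n)) j : pot (lpart x) j = pot x (lshift n j).
Proof. by rewrite /pot ffunE. Qed.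
Lemma cur_lpart m n (x : ports k (m + n)) j : cur (lpart x) j = cur x (lshift n j).
Proof. by rewrite /cur ffunE. Qed.
Lemma pot_rpart m n (x : ports k (m + n)) j : pot (rpart x) j = pot x (rshift m j).
Proof. by rewrite /pot ffunE. Qed.
Lemma cur_rpart m n (x : ports k (m + n)) j : cur (rpart x) j = cur x (rshift m j).
Proof. by rewrite /cur ffunE. Qed.

Lemma omega_symplectic n : symplectic (@omega k n).
Proof.
split.
- move=> a u u' v; rewrite /omega mulr_sumr -big_split; apply: eq_bigr => j _ /=.
  rewrite pot_lin cur_lin mulrDl mulrDr mulrBr opprD addrACA !mulrA.
  by rewrite (mulrC (pot v j) a).
- move=> a u v v'; rewrite /omega mulr_sumr -big_split; apply: eq_bigr => j _ /=.
  rewrite pot_lin cur_lin mulrDl mulrDr mulrBr opprD addrACA !mulrA.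
  by rewrite (mulrC (pot u j) a).
- by move=> u; rewrite /omega big1 // => j _; rewrite subrr.
- move=> u h; apply: ports_eq => j.
    have := h (mkports (fun=> 0) (fun i => (i == j)%:R)).
    rewrite /omega (bigD1 j) //= pot_mk cur_mk eqxx mulr1 mul0r subr0 big1 ?addr0.
      by move=> ->; rewrite pot0.
    by move=> i /negPf ij; rewrite pot_mk cur_mk ij mulr0 mul0r subr0.
  have := h (mkports (fun i => (i == j)%:R) (fun=> 0)).
  rewrite /omega (bigD1 j) //= pot_mk cur_mk eqxx mul1r mulr0 sub0r big1 ?addr0.
    by move/eqP; rewrite oppr_eq0 => /eqP ->; rewrite cur0.
  by move=> i /negPf ij; rewrite pot_mk cur_mk ij mulr0 mul0r subr0.
Qed.

Lemma omega_split m n (x y : ports k (m + n)) :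
  omega x y = omega (lpart x) (lpart y) + omega (rpart x) (rpart y).
Proof.
rewrite /omega big_split_ord /=; congr (_ + _); apply: eq_bigr => j _.
  by rewrite !pot_lpart !cur_lpart.
by rewrite !pot_rpart !cur_rpart.
Qed.

Definition join m n (x : ports k m) (y : ports k n) : ports k (m + n) :=
  [ffun i => match split i with inl j => x j | inr j => y j end].

Lemma join_l m n (x : ports k m) (y : ports k n) i : join x y (lshift n i) = x i.
Proof. by rewrite ffunE -[lshift n i]/(unsplit (inl i)) unsplitK. Qed.
Lemma join_r m n (x : ports k m) (y : ports k n) i : join x y (rshift m i) = y i.
Proof. by rewrite ffunE -[rshift m i]/(unsplit (inr i)) unsplitK. Qed.
Lemma lpart_join m n (x : ports k m) (y : ports k n) : lpart (join x y) = x.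
Proof. by apply/ffunP => i; rewrite ffunE join_l. Qed.
Lemma rpart_join m n (x : ports k m) (y : ports k n) : rpart (join x y) = y.
Proof. by apply/ffunP => i; rewrite ffunE join_r. Qed.
Lemma join_eta m n (x : ports k (m + n)) : join (lpart x) (rpart x) = x.
Proof.
by apply/ffunP => i; case: (split_ordP i) => j ->; rewrite (join_l, join_r) ffunE.
Qed.
Lemma join_inj m n (x y : ports k (m + n)) :
  lpart x = lpart y -> rpart x = rpart y -> x = y.
Proof. by move=> h1 h2; rewrite -(join_eta x) -(join_eta y) h1 h2. Qed.

Lemma lpart_lin m n a (x y : ports k (m + n)) :
  lpart (a *: x + y) = a *: lpart x + lpart y.
Proof. by apply/ffunP => i; rewrite !ffunE. Qed.
Lemma rpart_lin m n a (x y : ports k (m + n)) :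
  rpart (a *: x + y) = a *: rpart x + rpart y.
Proof. by apply/ffunP => i; rewrite !ffunE. Qed.
Lemma lpart0 m n : lpart (0 : ports k (m + n)) = 0.
Proof. by apply/ffunP => i; rewrite !ffunE. Qed.
Lemma rpart0 m n : rpart (0 : ports k (m + n)) = 0.
Proof. by apply/ffunP => i; rewrite !ffunE. Qed.

Lemma mem_rel_tens m n m' n'
    (R : {vspace ports k m * ports k n}) (S : {vspace ports k m' * ports k n'}) x y :
  (x, y) \in rel_tens R S <->
  (lpart x, lpart y) \in R /\ (rpart x, rpart y) \in S.
Proof.
rewrite mem_subspace //; split=> [|a [u1 u2] [v1 v2] /= [uR uS] [vR vS]].
  by rewrite /= !lpart0 !rpart0; split; exact: mem0v.
rewrite !lpart_lin !rpart_lin; split.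
  exact: (rpredD (rpredZ a uR) vR).
exact: (rpredD (rpredZ a uS) vS).
Qed.

Lemma mem_rel_sym m n (x : ports k (m + n)) (y : ports k (n + m)) :
  (x, y) \in rel_sym k m n <-> lpart x = rpart y /\ rpart x = lpart y.
Proof.
rewrite mem_subspace //; split=> [|a [u1 u2] [v1 v2] /= [h1 h2] [h3 h4]].
  by rewrite /= !lpart0 !rpart0.
by rewrite !lpart_lin !rpart_lin h1 h2 h3 h4.
Qed.

Let sp m n := symplectic_rel (omega_symplectic m) (omega_symplectic n).

Lemma lagrangian_tens m n m' n'
    (R : {vspace ports k m * ports k n}) (S : {vspace ports k m' * ports k n'}) :
  lagrangian (rel_form (@omega k m) (@omega k n)) R ->
  lagrangian (rel_form (@omega k m') (@omega k n')) S ->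
  lagrangian (rel_form (@omega k (m + m')) (@omega k (n + n'))) (rel_tens R S).
Proof.
move=> /(lagrangianP (sp _ _))[isoR mxR] /(lagrangianP (sp _ _))[isoS mxS].
have split_form x y (u : ports k (m + m')) (v : ports k (n + n')) :
    rel_form (@omega k (m + m')) (@omega k (n + n')) (x, y) (u, v) =
    rel_form (@omega k m) (@omega k n) (lpart x, lpart y) (lpart u, lpart v) +
    rel_form (@omega k m') (@omega k n') (rpart x, rpart y) (rpart u, rpart v).
  rewrite /rel_form /form_sum /form_conj /= !omega_split opprD addrACA.
  by [].
apply/(lagrangianP (sp _ _)); split.
  move=> [u1 u2] [v1 v2] /mem_rel_tens[uR uS] /mem_rel_tens[vR vS].
  by rewrite split_form isoR // isoS // addr0.
move=> [v1 v2] h; apply/mem_rel_tens; split.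
  apply: mxR => -[u1 u2] uR.
  have := h (join u1 0, join u2 0); rewrite split_form !lpart_join !rpart_join.
  rewrite (form0l (sp _ _)) addr0; apply; apply/mem_rel_tens.
  by rewrite !lpart_join !rpart_join; split=> //; exact: mem0v.
apply: mxS => -[u1 u2] uS.
have := h (join 0 u1, join 0 u2); rewrite split_form !lpart_join !rpart_join.
rewrite (form0l (sp _ _)) add0r; apply; apply/mem_rel_tens.
by rewrite !lpart_join !rpart_join; split=> //; exact: mem0v.
Qed.

Lemma lagrangian_sym m n :
  lagrangian (rel_form (@omega k (m + n)) (@omega k (n + m))) (rel_sym k m n).
Proof.
apply/(lagrangianP (sp _ _)); split.
  move=> [u1 u2] [v1 v2] /mem_rel_sym[hu1 hu2] /mem_rel_sym[hv1 hv2].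
  rewrite /rel_form /form_sum /form_conj /= !omega_split hu1 hu2 hv1 hv2.
  by rewrite addrC [X in X - _]addrC subrr.
move=> [v1 v2] h; apply/mem_rel_sym.
have key (a : ports k m) (b : ports k n) :
    omega a (rpart v2) + omega b (lpart v2) = omega a (lpart v1) + omega b (rpart v1).
  have := h (join a b, join b a); rewrite /rel_form /form_sum /form_conj /=.
  rewrite !omega_split !lpart_join !rpart_join => /(_ _)/eqP.
  rewrite addrC subr_eq0 => e; apply/eqP; rewrite addrC; apply: e.
  by apply/mem_rel_sym; rewrite !lpart_join !rpart_join.
have nd N (c d : ports k N) : (forall a, omega a c = omega a d) -> d = c.
  move=> e; apply/eqP; rewrite -subr_eq0; apply/eqP.
  apply: (form_nondeg (omega_symplectic N)) => a.
  rewrite (form_skew (omega_symplectic N)) (formDr (omega_symplectic N)).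
  by rewrite (formNr (omega_symplectic N)) e subrr oppr0.
split; apply: nd => a.
  by have := key a 0; rewrite !(form0l (omega_symplectic _)) !addr0.
by have := key 0 a; rewrite !(form0l (omega_symplectic _)) !add0r.
Qed.

Definition LagRel_ops : prop_ops := {|
  hom m n := lag_rel k m n;
  idm m := exist _ (rel_id (ports k m)) (lagrangian_id (omega_symplectic m));
  compm m n p R S := exist _ (rel_comp (sval R) (sval S))
    (lagrangian_comp (omega_symplectic m) (omega_symplectic n)
       (omega_symplectic p) (svalP R) (svalP S));
  tensm m n m' n' R S := exist _ (rel_tens (sval R) (sval S))
    (lagrangian_tens (svalP R) (svalP S));
  symm m n := exist _ (rel_sym k m n) (lagrangian_sym m n) |}.

Definition related m n (R : hom LagRel_ops m n) (x : ports k m) (y : ports k n) : Prop :=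
  (x, y) \in sval R.

Lemma lag_rel_eq m n (R S : hom LagRel_ops m n) :
  (forall x y, related R x y <-> related S x y) -> R = S.
Proof.
case: R S => [R HR] [S HS] h; apply: eq_exist; apply/vspaceP => -[x y].
by apply/idP/idP => /h.
Qed.

Lemma lag_rel_sub m n (R S : hom LagRel_ops m n) :
  (forall x y, related R x y -> related S x y) -> R = S.
Proof.
case: R S => [R HR] [S HS] h; apply: eq_exist.
by apply: (lagrangian_eq HR HS) => -[x y]; exact: h.
Qed.

Lemma related_id m x y : related (idm m : hom LagRel_ops m m) x y <-> x = y.
Proof. exact: mem_rel_id. Qed.

Lemma related_comp m n p (R : hom LagRel_ops m n) (S : hom LagRel_ops n p) x z :
  related (compm R S) x z <-> exists y, related R x y /\ related S y z.
Proof. exact: mem_rel_comp. Qed.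

Lemma related_tens m n m' n' (R : hom LagRel_ops m n) (S : hom LagRel_ops m' n') x y :
  related (tensm R S) x y <->
  related R (lpart x) (lpart y) /\ related S (rpart x) (rpart y).
Proof. exact: mem_rel_tens. Qed.

Lemma related_sym m n x y : related (symm m n : hom LagRel_ops _ _) x y <->
  lpart x = rpart y /\ rpart x = lpart y.
Proof. exact: mem_rel_sym. Qed.

Definition cast_ports m n (e : m = n) (x : ports k n) : ports k m :=
  [ffun i => x (cast_ord e i)].

Lemma related_cast m n m' n' (em : m = m') (en : n = n') (R : hom LagRel_ops m n) x y :
  related (castm em en R) x y <-> related R (cast_ports em x) (cast_ports en y).
Proof.
have ce N (z : ports k N) : cast_ports erefl z = z.
  by apply/ffunP => i; rewrite ffunE cast_ord_id.
by case: _ / em x; case: _ / en y => y x; rewrite !ce.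
Qed.

Lemma cast_portsK m n (e : m = n) (e' : n = m) (x : ports k n) :
  cast_ports e' (cast_ports e x) = x.
Proof. by apply/ffunP => i; rewrite !ffunE; congr (x _); exact/val_inj. Qed.

Lemma cast_assoc_l m n p (x : ports k (m + n + p)) :
  lpart (cast_ports (addnA m n p) x) = lpart (lpart x).
Proof. by apply/ffunP => i; rewrite !ffunE; congr (x _); exact/val_inj. Qed.
Lemma cast_assoc_m m n p (x : ports k (m + n + p)) :
  lpart (rpart (cast_ports (addnA m n p) x)) = rpart (lpart x).
Proof. by apply/ffunP => i; rewrite !ffunE; congr (x _); exact/val_inj. Qed.
Lemma cast_assoc_r m n p (x : ports k (m + n + p)) :
  rpart (rpart (cast_ports (addnA m n p) x)) = rpart x.
Proof.
by apply/ffunP => i; rewrite !ffunE; congr (x _); apply/val_inj; rewrite /= addnA.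
Qed.

Lemma castV_assoc_l m n p (x : ports k (m + (n + p))) :
  lpart (lpart (cast_ports (esym (addnA m n p)) x)) = lpart x.
Proof. by rewrite -cast_assoc_l cast_portsK. Qed.
Lemma castV_assoc_m m n p (x : ports k (m + (n + p))) :
  rpart (lpart (cast_ports (esym (addnA m n p)) x)) = lpart (rpart x).
Proof. by rewrite -cast_assoc_m cast_portsK. Qed.
Lemma castV_assoc_r m n p (x : ports k (m + (n + p))) :
  rpart (cast_ports (esym (addnA m n p)) x) = rpart (rpart x).
Proof. by rewrite -cast_assoc_r cast_portsK. Qed.
Lemma cast_ports_id n (x : ports k n) : cast_ports erefl x = x.
Proof. by apply/ffunP => i; rewrite ffunE cast_ord_id. Qed.

Lemma ports0 (x y : ports k 0) : x = y.
Proof. by apply/ffunP => -[]. Qed.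

Lemma LagRel_is_prop : is_prop LagRel_ops.
Proof.
split.
- move=> m n R; apply: lag_rel_eq => x y; rewrite related_comp.
  by split=> [[z [/related_id -> //]]|Rxy]; exists x; split=> //; exact/related_id.
- move=> m n R; apply: lag_rel_eq => x y; rewrite related_comp.
  by split=> [[z [h /related_id <- //]]|Rxy]; exists y; split=> //; exact/related_id.
- move=> m n p q f g h; apply: lag_rel_eq => x y; rewrite !related_comp; split.
    move=> [u [fu /related_comp[v [gv hv]]]]; exists v; split=> //.
    by apply/related_comp; exists u.
  move=> [v [/related_comp[u [fu gv]] hv]]; exists u; split=> //.
  by apply/related_comp; exists v.
- move=> m n; apply: lag_rel_eq => x y; rewrite related_tens !related_id.
  by split=> [[]|->//]; exact: join_inj.
- move=> m n p m' n' p' f g f' g'; apply: lag_rel_eq => x y.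
  rewrite related_tens !related_comp; split.
    move=> [[u [fu gu]] [v [fv gv]]]; exists (join u v); rewrite !related_tens.
    by rewrite !lpart_join !rpart_join.
  move=> [u [/related_tens[f1 f2] /related_tens[g1 g2]]].
  by split; [exists (lpart u)|exists (rpart u)].
- move=> m n m' n' m'' n'' f f' f''; apply: lag_rel_eq => x y.
  rewrite related_cast !related_tens !cast_assoc_l !cast_assoc_m !cast_assoc_r.
  by split=> [[h1 [h2 h3]]|[[h1 h2] h3]].
- move=> m n f; apply: lag_rel_eq => x y; rewrite related_cast related_tens related_id.
  have e N (z : ports k N) : rpart (cast_ports (add0n N) z) = z.
    by apply/ffunP => i; rewrite !ffunE; congr (z _); exact/val_inj.
  by rewrite !e; split=> [[]//|]; split=> //; exact: ports0.
- move=> m n f; apply: lag_rel_eq => x y; rewrite related_cast related_tens related_id.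
  have e N (z : ports k N) : lpart (cast_ports (addn0 N) z) = z.
    by apply/ffunP => i; rewrite !ffunE; congr (z _); exact/val_inj.
  by rewrite !e; split=> [[]//|]; split=> //; exact: ports0.
- move=> m n m' n' f f'; apply: lag_rel_eq => x y; rewrite !related_comp; split.
    move=> [u [/related_tens[h1 h2] /related_sym[e1 e2]]]; exists (join (rpart x) (lpart x)).
    by rewrite related_sym related_tens !lpart_join !rpart_join -e1 -e2.
  move=> [u [/related_sym[e1 e2] /related_tens[h1 h2]]]; exists (join (rpart y) (lpart y)).
  by rewrite related_sym related_tens !lpart_join !rpart_join e1 e2.
- move=> m n; apply: lag_rel_eq => x y; rewrite !related_comp related_id; split.
    by move=> [u [/related_sym[e1 e2] /related_sym[e3 e4]]]; apply: join_inj; congruence.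
  move=> <-; exists (join (rpart x) (lpart x)).
  by rewrite !related_sym !lpart_join !rpart_join.
- move=> m n p; apply: lag_rel_eq => x y; rewrite related_comp related_sym.
  have E (u : ports k (n + (m + p))) :
      related (castm (esym (addnA m n p)) (esym (addnA n m p))
        (tensm (symm m n) (idm p)) : hom LagRel_ops _ _) x u /\
      related (castm erefl (addnA n p m)
        (tensm (idm n) (symm m p)) : hom LagRel_ops _ _) u y <->
      ((lpart x = lpart (rpart u) /\ lpart (rpart x) = lpart u) /\
        rpart (rpart x) = rpart (rpart u)) /\
      (lpart u = lpart (lpart y) /\
       (lpart (rpart u) = rpart y /\ rpart (rpart u) = rpart (lpart y))).
    rewrite !related_cast !related_tens !related_sym !related_id cast_ports_id.
    by rewrite !castV_assoc_l !castV_assoc_m !castV_assoc_r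
      !cast_assoc_l !cast_assoc_m !cast_assoc_r.
  split=> [[e1 e2]|[u /E[[[e1 e2] e3] [e4 [e5 e6]]]]].
    exists (join (lpart (rpart x)) (join (lpart x) (rpart (rpart x)))); apply/E.
    by rewrite !(lpart_join, rpart_join) e1 e2.
  by split; [|apply: join_inj]; congruence.
Qed.
End LagRel.

Definition LagRel (k : fieldType) : prop := MkProp (LagRel_is_prop k).

(* The four generators in the order multiplication, comultiplication, unit,   *)
(* counit; on two terminals, ord0 is the first and ord_max the second.        *)
Record K_spec (k : fieldType) (K : prop_morphism FinCorel (LagRel k)) : Prop :=
  KSpec {
  K_mul : forall x y, related (K 2 1 (one_part (erefl : 0 < 2 + 1)%N)) x y <->
    [/\ pot x ord0 = pot x ord_max, pot x ord_max = pot y ord0 &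
        cur x ord0 + cur x ord_max = cur y ord0];
  K_comul : forall x y, related (K 1 2 (one_part (erefl : 0 < 1 + 2)%N)) x y <->
    [/\ pot x ord0 = pot y ord0, pot y ord0 = pot y ord_max &
        cur x ord0 = cur y ord0 + cur y ord_max];
  K_unit : forall x y, related (K 0 1 (one_part (erefl : 0 < 0 + 1)%N)) x y <->
    cur y ord0 = 0;
  K_counit : forall x y, related (K 1 0 (one_part (erefl : 0 < 1 + 0)%N)) x y <->
    cur x ord0 = 0 }.

Section KExists.
Variable k : fieldType.
Implicit Types m n p q : nat.

(* Closed form of K, used only to establish its existence: potentials are     *)
(* constant on parts, and the currents entering and leaving a part have equal *)
(* sums.                                                                      *)
Definition kirchhoff m n (c : cospan m n) (x : ports k m) (y : ports k n) : Prop :=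
  (exists v : apex c -> k,
     (forall i, pot x i = v (lin c i)) /\ (forall j, pot y j = v (lout c j))) /\
  forall a : apex c,
    \sum_(i | lin c i == a) cur x i = \sum_(j | lout c j == a) cur y j.

Definition cospan_rel m n (c : cospan m n) : {vspace ports k m * ports k n} :=
  subspace (fun u => kirchhoff c u.1 u.2).

Lemma mem_cospan_rel m n (c : cospan m n) x y :
  (x, y) \in cospan_rel c <-> kirchhoff c x y.
Proof.
rewrite mem_subspace //; split=> [|a [x1 y1] [x2 y2]].
  split=> [|a]; first by exists (fun=> 0); split=> i; rewrite pot0.
  by rewrite !big1 // => i _; rewrite cur0.
move=> [[v1 [vx1 vy1]] h1] [[v2 [vx2 vy2]] h2]; split.
  exists (fun b => a * v1 b + v2 b).
  by split=> i; rewrite /= pot_lin ?vx1 ?vx2 ?vy1 ?vy2.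
move=> b; move: (h1 b) (h2 b) => /= {}h1 {}h2.
under eq_bigr do rewrite cur_lin.
under [RHS]eq_bigr do rewrite cur_lin.
by rewrite !big_split -!mulr_sumr /= h1 h2.
Qed.

Lemma sum_fibers (A B : finType) (f : A -> B) (v : B -> k) (F : A -> k) :
  \sum_i v (f i) * F i = \sum_b v b * \sum_(i | f i == b) F i.
Proof.
rewrite (partition_big f xpredT) //=; apply: eq_bigr => b _.
by rewrite mulr_sumr; apply: eq_bigr => i /eqP ->.
Qed.

Lemma cospan_rel_lagrangian m n (c : cospan m n) :
  lagrangian (rel_form (@omega k m) (@omega k n)) (cospan_rel c).
Proof.
have sp := symplectic_rel (omega_symplectic k m) (omega_symplectic k n).
apply/(lagrangianP sp); split.
  move=> [x y] [x' y'] /mem_cospan_rel[[v [vx vy]] h] /mem_cospan_rel[[v' [vx' vy']] h'].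
  rewrite /rel_form /form_sum /form_conj /omega /= !big_split /= !sumrN.
  have e N (f : 'I_N -> apex c) (u : apex c -> k) (z z' : ports k N) :
      (forall i, pot z i = u (f i)) ->
      \sum_i pot z i * cur z' i = \sum_b u b * \sum_(i | f i == b) cur z' i.
    by move=> zu; rewrite -sum_fibers; apply: eq_bigr => i _; rewrite zu.
  rewrite (e _ _ _ x x' vx) (e _ _ _ x' x vx') (e _ _ _ y y' vy) (e _ _ _ y' y vy').
  under eq_bigr do rewrite h'.
  under [\sum_b v' b * _]eq_bigr do rewrite h.
  by rewrite addNr.
move=> [x y] H; apply/mem_cospan_rel.
have test u w : kirchhoff c u w ->
    \sum_(i < m) (pot u i * cur x i - pot x i * cur u i) =
    \sum_(j < n) (pot w j * cur y j - pot y j * cur w j).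
  move=> /mem_cospan_rel /H; rewrite /rel_form /form_sum /form_conj /omega /=.
  by move/eqP; rewrite addrC subr_eq0 => /eqP ->.
split; last first.
  move=> a; pose ind b : k := (b == a)%:R.
  have := test (mkports (ind \o lin c) (fun=> 0)) (mkports (ind \o lout c) (fun=> 0)).
  have simp N (z : ports k N) (f : 'I_N -> apex c) :
      \sum_(i < N) (pot (mkports (ind \o f) (fun=> 0)) i * cur z i -
         pot z i * cur (mkports (ind \o f) (fun=> 0)) i) = \sum_(i | f i == a) cur z i.
    rewrite [RHS]big_mkcond /=; apply: eq_bigr => i _.
    rewrite pot_mk cur_mk mulr0 subr0 /= /ind.
    by case: (f i == a); rewrite (mul1r, mul0r).
  rewrite !simp; apply; split.
    by exists ind; split=> i; rewrite pot_mk.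
  by move=> b; rewrite !big1 // => i _; rewrite cur_mk.
pose node (t : 'I_m + 'I_n) := match t with inl i => lin c i | inr j => lout c j end.
pose P (t : 'I_m + 'I_n) := match t with inl i => pot x i | inr j => pot y j end.
have agree s t : node s = node t -> P s = P t.
  move=> st; pose J r : k := (r == s)%:R - (r == t)%:R.
  have sumJ (F : 'I_m + 'I_n -> k) :
      \sum_i F (inl i) * J (inl i) + \sum_j F (inr j) * J (inr j) = F s - F t.
    rewrite -(big_sumType _ xpredT (fun r => F r * J r)) /=.
    under eq_bigr do rewrite mulrBr; rewrite sumrB.
    have dl u : \sum_r F r * (r == u)%:R = F u.
      rewrite (bigD1 u) //= eqxx mulr1 big1 ?addr0 // => r /negPf ->.
      by rewrite mulr0.
    by rewrite !dl.
  have := test (mkports (fun=> 0) (J \o inl)) (mkports (fun=> 0) (fun j => - J (inr j))).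
  have simp N (z : ports k N) (f : 'I_N -> k) :
      \sum_(i < N) (pot (mkports (fun=> 0) f) i * cur z i -
         pot z i * cur (mkports (fun=> 0) f) i) = - \sum_(i < N) pot z i * f i.
    rewrite -sumrN; apply: eq_bigr => i _.
    by rewrite pot_mk cur_mk mul0r sub0r.
  rewrite !simp => e.
    have e' : \sum_j pot y j * - J (inr j) = - \sum_j P (inr j) * J (inr j).
      by rewrite -sumrN; apply: eq_bigr => j _; rewrite mulrN.
    apply/eqP; rewrite -subr_eq0 -(sumJ P) -oppr_eq0 opprD.
    move: e; rewrite e' => ->; first by rewrite opprK subrr.
  split; first by exists (fun=> 0); split=> i; rewrite pot_mk.
  move=> b; have := sumJ (fun r => (node r == b)%:R); rewrite st subrr.
  move/eqP; rewrite addr_eq0 => /eqP e1.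
  under eq_bigr do rewrite cur_mk; under [RHS]eq_bigr do rewrite cur_mk.
  rewrite sumrN big_mkcond [in RHS]big_mkcond /=.
  transitivity (\sum_i (node (inl i) == b)%:R * J (inl i)).
    by apply: eq_bigr => i _ /=; case: (_ == b); rewrite (mul1r, mul0r).
  rewrite e1; congr (- _); apply: eq_bigr => i _ /=.
  by case: (_ == b); rewrite (mul1r, mul0r).
exists (fun a => if [pick t | node t == a] is Some t then P t else 0).
split=> i; case: pickP => [t /eqP nt|/(_ _)/eqP no].
- by rewrite -[LHS]/(P (inl i)); apply: agree; rewrite nt.
- by case: (no (inl i)).
- by rewrite -[LHS]/(P (inr i)); apply: agree; rewrite nt.
- by case: (no (inr i)).
Qed.

Definition crel m n (c : cospan m n) : hom (LagRel k) m n :=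
  exist _ (cospan_rel c) (cospan_rel_lagrangian c).

Lemma related_crel m n (c : cospan m n) x y : related (crel c) x y <-> kirchhoff c x y.
Proof. exact: mem_cospan_rel. Qed.

Lemma crel_inj m n (c d : cospan m n) (f : apex c -> apex d) :
  injective f -> (forall i, f (lin c i) = lin d i) ->
  (forall j, f (lout c j) = lout d j) -> crel c = crel d.
Proof.
move=> f_inj f1 f2; apply/esym/lag_rel_sub => x y.
move=> /related_crel[[v [vx vy]] h]; apply/related_crel; split.
  by exists (v \o f); split=> i /=; rewrite (f1, f2).
move=> a; have := h (f a).
under eq_bigl do rewrite -f1 (inj_eq f_inj).
by under [RHS]eq_bigl do rewrite -f2 (inj_eq f_inj).
Qed.

Lemma crel_iso m n (c d : cospan m n) : cospan_iso c d -> crel c = crel d.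
Proof. by case=> f [/bij_inj f_inj f1 f2]; exact: crel_inj f_inj f1 f2. Qed.

Lemma crel_restrict m n (c : cospan m n) : crel (restrict c) = crel c.
Proof. by apply: (@crel_inj _ _ (restrict c) c val) => //; exact: val_inj. Qed.

Lemma crel_id m : crel (cospan_id m) = idm m.
Proof.
apply/esym/lag_rel_sub => x y /related_id <-; apply/related_crel.
by split=> //; exists (pot x).
Qed.

Lemma crel_sym m n : crel (cospan_sym m n) = symm m n.
Proof.
apply/esym/lag_rel_sub => x y /related_sym[e1 e2]; apply/related_crel.
have sw j : y j = x (swap_ord j).
  case: (split_ordP j) => i ->; rewrite (swap_ord_l, swap_ord_r).
    by have /ffunP/(_ i) := e2; rewrite !ffunE.
  by have /ffunP/(_ i) := e1; rewrite !ffunE.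
split; first by exists (pot x); split=> // j; rewrite /pot sw.
move=> a; rewrite big_pred1_eq (big_pred1 (swap_ord a)).
  by rewrite /cur sw swap_ordK.
by move=> j; rewrite /= (can2_eq (@swap_ordK _ _) (@swap_ordK _ _)).
Qed.

Lemma sum_pred_comp (A B C : finType) (f : A -> B) (g : B -> C) b (F : A -> k) :
  \sum_(i | g (f i) == b) F i = \sum_(a | g a == b) \sum_(i | f i == a) F i.
Proof.
rewrite (partition_big f (fun a => g a == b)) //=.
apply: eq_bigr => a /eqP ga; apply: eq_bigl => i.
by case: (f i =P a) => [->|]; rewrite ?ga ?eqxx // andbF.
Qed.

Lemma crel_comp m n p (c : cospan m n) (d : cospan n p) :
  crel (cospan_comp c d) = compm (crel c) (crel d).
Proof.
apply/esym/lag_rel_sub => x z /related_comp[y].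
move=> [/related_crel[[v [vx vy]] h] /related_crel[[w [wy wz]] h']].
apply/related_crel; split.
  have ok j : v (lout c j) = w (lin d j) by rewrite -vy wy.
  by exists (po_desc v w); split=> i; rewrite /= (po_desc_l, po_desc_r).
move=> a; rewrite /= sum_pred_comp [RHS]sum_pred_comp.
under eq_bigr do rewrite h; under [RHS]eq_bigr do rewrite -h'.
rewrite -!sum_pred_comp; apply: eq_bigl => j.
by rewrite po_glue.
Qed.

Lemma crel_tens m n m' n' (c : cospan m n) (d : cospan m' n') :
  crel (cospan_tens c d) = tensm (crel c) (crel d).
Proof.
apply/esym/lag_rel_sub => x y /related_tens.
move=> [/related_crel[[v [vx vy]] h] /related_crel[[w [wx wy]] h']].
have vx' i := etrans (esym (pot_lpart x i)) (vx i).
have vy' i := etrans (esym (pot_lpart y i)) (vy i).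
have wx' i := etrans (esym (pot_rpart x i)) (wx i).
have wy' i := etrans (esym (pot_rpart y i)) (wy i).
apply/related_crel; split.
  exists (fun a => match a with inl a => v a | inr a => w a end).
  by split=> i; case: (split_ordP i) => j -> /=; rewrite (tens_leg_l, tens_leg_r).
have suml N N' (A B : finType) (f : 'I_N -> A) (g : 'I_N' -> B) (z : ports k (N + N')) a :
    \sum_(i | tens_leg f g i == inl a) cur z i = \sum_(i | f i == a) cur (lpart z) i.
  rewrite big_mkcond big_split_ord /= [X in _ + X]big1 => [|i _]; last by rewrite tens_leg_r.
  rewrite addr0 [RHS]big_mkcond; apply: eq_bigr => i _.
  by rewrite tens_leg_l cur_lpart (inj_eq (@inl_inj _ _)).
have sumr N N' (A B : finType) (f : 'I_N -> A) (g : 'I_N' -> B) (z : ports k (N + N')) a :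
    \sum_(i | tens_leg f g i == inr a) cur z i = \sum_(i | g i == a) cur (rpart z) i.
  rewrite big_mkcond big_split_ord /= big1 => [|i _]; last by rewrite tens_leg_l.
  rewrite add0r [RHS]big_mkcond; apply: eq_bigr => i _.
  by rewrite tens_leg_r cur_rpart (inj_eq (@inr_inj _ _)).
by case=> a; rewrite /= !(suml, sumr).
Qed.

Definition K_fun m n (f : hom FinCorel m n) : hom (LagRel k) m n :=
  crel (sval (qrepr f)).

Lemma K_funE m n (c : corel m n) : K_fun (corel_class c) = crel (sval c).
Proof. by apply: crel_iso; apply: repr_cls (corel_eqv _ _) _. Qed.

Lemma K_is_morphism : @is_prop_morphism FinCorel (LagRel k) K_fun.
Proof.
split.
- by move=> m; rewrite [LHS]K_funE crel_id.
- move=> m n p f g; case: (corl_surj f) => {f}c ->; case: (corl_surj g) => {g}d ->.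
  by rewrite [compm _ _]corl_comp !K_funE crel_restrict crel_comp.
- move=> m n p q f g; case: (corl_surj f) => {f}c ->; case: (corl_surj g) => {g}d ->.
  by rewrite [tensm _ _]corl_tens !K_funE crel_tens.
- by move=> m n; rewrite [LHS]K_funE crel_sym.
Qed.

Lemma K_exists : exists K, @K_spec k K.
Proof.
have onepartE m n (mn : (0 < m + n)%N) x y :
    related (K_fun (one_part mn)) x y <->
    (exists v, (forall i, pot x i = v) /\ (forall j, pot y j = v)) /\
    \sum_i cur x i = \sum_j cur y j.
  rewrite /one_part K_funE related_crel /kirchhoff /=; split=> [[[v [vx vy]] h]|[[v [vx vy]] h]].
    by split; [exists (v tt) | have := h tt].
  by split; [exists (fun=> v) | case].
exists (@PropMorphism FinCorel (LagRel k) _ K_is_morphism).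
have sum2 (F : 'I_2 -> k) : \sum_i F i = F ord0 + F ord_max.
  by rewrite !big_ord_recl big_ord0 addr0; congr (_ + F _); exact/val_inj.
have all2 (P : 'I_2 -> Prop) : P ord0 -> P ord_max -> forall i, P i.
  move=> P0 P1 [[|[|//]] hi]; [move: P0|move: P1]; congr P; exact/val_inj.
split=> x y /=; rewrite onepartE ?sum2 ?big_ord1 ?big_ord0.
- split=> [[[v [vx vy]] h]|[h1 h2 h3]]; first by rewrite !vx !vy.
  split=> //; exists (pot y ord0); split=> [|i]; last by rewrite ord1.
  by apply: (all2 (fun i => pot x i = _)); rewrite ?h1.
- split=> [[[v [vx vy]] h]|[h1 h2 h3]]; first by rewrite !vx !vy.
  split=> //; exists (pot x ord0); split=> [i|]; first by rewrite ord1.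
  by apply: (all2 (fun i => pot y i = _)); rewrite -?h2.
- split=> [[_ ->//]|h]; split=> //.
  by exists (pot y ord0); split=> [[]|i] //; rewrite ord1.
- split=> [[_ ->//]|h]; split=> //.
  by exists (pot x ord0); split=> [i|[]] //; rewrite ord1.
Qed.
End KExists.

Lemma ord_fun_ind (P : forall m n, ('I_m -> 'I_n) -> Prop) :
  (forall m, P m m id) ->
  (forall m n p (f : 'I_m -> 'I_n) (g : 'I_n -> 'I_p),
     P m n f -> P n p g -> P m p (g \o f)) ->
  (forall m n m' n' (f : 'I_m -> 'I_n) (f' : 'I_m' -> 'I_n'),
     P m n f -> P m' n' f' -> P _ _ (ord_sum f f')) ->
  (forall m n, P _ _ (@swap_ord m n)) ->
  P 2 1 (fun=> ord0) -> P 0 1 (fun=> ord0) ->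
  forall m n f, P m n f.
Proof.
move=> Pid Pcomp Psum Pswap Pmul Punit.
pose merge n (a : 'I_n) (i : 'I_(1 + n)) : 'I_n :=
  match split i with inl _ => a | inr j => j end.
have merge_l n a i : @merge n a (lshift n i) = a.
  by rewrite /merge -[lshift n i]/(unsplit (inl i)) unsplitK.
have merge_r n a i : @merge n a (rshift 1 i) = i.
  by rewrite /merge -[rshift 1 i]/(unsplit (inr i)) unsplitK.
have Pmerge n a : P (1 + n)%N n (@merge n a).
  elim: n a => [[]//|n IH] a; case: (@split_ordP 1 n a) => b ->.
    have -> : merge (1 + n)%N (lshift n b) =
              @ord_sum 1 2 n n (fun=> ord0) id :> ('I_(2 + n) -> 'I_(1 + n)).
      apply: funext => i; case: (@split_ordP 2 n i) => j ->; rewrite /ord_sum.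
        rewrite tens_leg_l /=; case: (@split_ordP 1 1 j) => j' ->.
          have -> : lshift n (lshift 1 j') = lshift (1 + n) j' by exact/val_inj.
          by rewrite merge_l; apply/val_inj; rewrite /= !ord1.
        have -> : lshift n (rshift 1 j') = rshift 1 (lshift n j') by exact/val_inj.
        by rewrite merge_r; apply/val_inj; rewrite /= !ord1.
      rewrite tens_leg_r /=.
      have -> : rshift 2 j = rshift 1 (rshift 1 j) by exact/val_inj.
      by rewrite merge_r.
    exact: (@Psum 2 1 n n (fun=> ord0) id Pmul (Pid n)).
  have -> : merge (1 + n)%N (rshift 1 b) =
     (@ord_sum 1 1 n (1 + n) id (@merge n b)) \o
     (@ord_sum 2 2 n n (@swap_ord 1 1) id) :> ('I_(2 + n) -> 'I_(1 + n)).
    apply: funext => i /=; case: (@split_ordP 2 n i) => j ->; rewrite /ord_sum.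
      rewrite tens_leg_l /=; case: (@split_ordP 1 1 j) => j' ->.
        have -> : lshift n (lshift 1 j') = lshift (1 + n) j' by exact/val_inj.
        rewrite merge_l swap_ord_l.
        have -> : lshift n (rshift 1 j') = rshift 1 (lshift n j') by exact/val_inj.
        by rewrite tens_leg_r /= merge_l.
      have -> : lshift n (rshift 1 j') = rshift 1 (lshift n j') by exact/val_inj.
      rewrite merge_r swap_ord_r.
      have -> : lshift n (lshift 1 j') = lshift (1 + n) j' by exact/val_inj.
      by rewrite tens_leg_l.
    rewrite tens_leg_r /=.
    have -> : rshift 2 j = rshift 1 (rshift 1 j) by exact/val_inj.
    by rewrite merge_r tens_leg_r /= merge_r.
  apply: (Pcomp _ _ _ _ _ (@Psum 2 2 n n (@swap_ord 1 1) id (Pswap 1 1) (Pid n))).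
  exact: (@Psum 1 1 (1 + n) n id (@merge n b) (Pid 1) (IH b)).
elim=> [|m IH] n f.
  elim: n f => [|n IH] f.
    by have -> : f = id by apply: funext => -[].
  have -> : f = @ord_sum 1 0 n 0 (fun=> ord0) (fun i => False_rect _ (notF (ltn_ord i))).
    by apply: funext => -[].
  exact: (@Psum 0 1 0 n _ _ Punit (IH _)).
have -> : f = merge n (f ord0) \o @ord_sum 1 1 n m id (f \o @rshift 1 m).
  apply: funext => i /=; case: (@split_ordP 1 m i) => j ->; rewrite /ord_sum.
    by rewrite tens_leg_l /= merge_l; congr f; apply/val_inj; rewrite /= ord1.
  by rewrite tens_leg_r /= merge_r.
apply: (Pcomp _ _ _ _ _ (@Psum 1 1 m n id _ (Pid 1) (IH _ _)) (Pmerge n (f ord0))).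
Qed.

Section Generation.
Implicit Types m n p q : nat.

Definition fwd m n (f : 'I_m -> 'I_n) : hom FinCospan m n := cospan_class (@Cospan m n 'I_n f id).
Definition bwd m n (f : 'I_m -> 'I_n) : hom FinCospan n m := cospan_class (@Cospan n m 'I_n id f).

Lemma fwd_comp m n p (f : 'I_m -> 'I_n) (g : 'I_n -> 'I_p) :
  compm (fwd f) (fwd g) = fwd (g \o f).
Proof.
rewrite [LHS]cosp_comp; apply/cospP; pose F := @po_desc _ _ _ id g _ g id.
have Fl x : F (po_l x) = g x by rewrite /F po_desc_l.
have Fr x : F (po_r x) = x by rewrite /F po_desc_r.
exists F; split; [|by move=> i; exact: Fl|by move=> i; exact: Fr].
exists po_r => x; last exact: Fr.
by case: (poP x) => y; rewrite (Fl, Fr) // -(po_glue id g).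
Qed.

Lemma bwd_comp m n p (f : 'I_m -> 'I_n) (g : 'I_n -> 'I_p) :
  compm (bwd g) (bwd f) = bwd (g \o f).
Proof.
rewrite [LHS]cosp_comp; apply/cospP; pose F := @po_desc _ _ _ g id _ id g.
have Fl x : F (po_l x) = x by rewrite /F po_desc_l.
have Fr x : F (po_r x) = g x by rewrite /F po_desc_r.
exists F; split; [|by move=> i; exact: Fl|by move=> i; exact: Fr].
exists po_l => x; last exact: Fl.
by case: (poP x) => y; rewrite (Fl, Fr) // (po_glue g id).
Qed.

Lemma fwd_tens m n m' n' (f : 'I_m -> 'I_n) (g : 'I_m' -> 'I_n') :
  tensm (fwd f) (fwd g) = fwd (ord_sum f g).
Proof.
rewrite [LHS]cosp_tens; apply/cospP; exists (@unsplit n n'); split=> //.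
  by exists (@split n n'); [exact: unsplitK | exact: splitK].
by move=> i; case: (split_ordP i) => j -> /=; rewrite (tens_leg_l, tens_leg_r).
Qed.

Lemma bwd_tens m n m' n' (f : 'I_m -> 'I_n) (g : 'I_m' -> 'I_n') :
  tensm (bwd f) (bwd g) = bwd (ord_sum f g).
Proof.
rewrite [LHS]cosp_tens; apply/cospP; exists (@unsplit n n'); split=> //.
  by exists (@split n n'); [exact: unsplitK | exact: splitK].
by move=> i; case: (split_ordP i) => j -> /=; rewrite (tens_leg_l, tens_leg_r).
Qed.

Lemma fwd_swap m n : fwd (@swap_ord m n) = symm n m.
Proof.
apply/cospP; exists (@swap_ord n m); split=> //=.
- by exists (@swap_ord m n); exact: swap_ordK.
- by move=> i; rewrite swap_ordK.
Qed.

Lemma cosp_fwd_bwd m n (c : cospan m n) :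
  cospan_class c = compm (fwd (enum_rank \o lin c)) (bwd (enum_rank \o lout c)).
Proof.
rewrite [RHS]cosp_comp; apply/cospP.
exists (fun x => po_l (enum_rank x)); split=> [|//|j]; last exact: (po_glue id id).
pose F := @po_desc _ _ _ id id _ (@enum_val _ (apex c)) (@enum_val _ (apex c)).
exists F => [x|x]; first by rewrite /F po_desc_l // enum_rankK.
by case: (poP x) => y; rewrite /F ?po_desc_l ?po_desc_r // enum_valK // (po_glue id id).
Qed.

Definition node m n : hom FinCospan m n := cospan_class (@Cospan m n unit (fun=> tt) (fun=> tt)).

Lemma cospan_generated (Q : prop) (F G : prop_morphism FinCospan Q) :
  F _ _ (node 2 1) = G _ _ (node 2 1) -> F _ _ (node 1 2) = G _ _ (node 1 2) ->
  F _ _ (node 0 1) = G _ _ (node 0 1) -> F _ _ (node 1 0) = G _ _ (node 1 0) ->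
  F = G.
Proof.
case: (morphP F) (morphP G) => F1 F2 F3 F4 [G1 G2 G3 G4] e21 e12 e01 e10.
have nodeE m n (c : cospan m n) (f : apex c -> unit) : bijective f ->
    node m n = cospan_class c.
  case=> f' fK f'K; apply/cospP; exists f'; split; first by exists f.
    by move=> i; rewrite -[RHS]fK; congr f'; case: (f _).
  by move=> i; rewrite -[RHS]fK; congr f'; case: (f _).
have I1b : bijective (fun _ : 'I_1 => tt).
  by exists (fun=> ord0); [move=> x; rewrite [RHS]ord1 | case].
apply: prop_morphism_eq => m n c; case: (cosp_surj c) => {}c ->.
rewrite cosp_fwd_bwd F2 G2; congr compm.
  apply: (@ord_fun_ind (fun m n f => F _ _ (fwd f) = G _ _ (fwd f))).
  - by move=> p; rewrite F1 G1.
  - by move=> ? ? ? f g hf hg; rewrite -fwd_comp F2 G2 hf hg.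
  - by move=> ? ? ? ? f g hf hg; rewrite -fwd_tens F3 G3 hf hg.
  - by move=> ? ?; rewrite fwd_swap F4 G4.
  - by rewrite /fwd -(nodeE _ _ (@Cospan 2 1 'I_1 (fun=> ord0) id) _ I1b).
  - by rewrite /fwd -(nodeE _ _ (@Cospan 0 1 'I_1 (fun=> ord0) id) _ I1b).
apply: (@ord_fun_ind (fun m n f => F _ _ (bwd f) = G _ _ (bwd f))).
- by move=> p; rewrite F1 G1.
- by move=> ? ? ? f g hf hg; rewrite -bwd_comp F2 G2 hf hg.
- by move=> ? ? ? ? f g hf hg; rewrite -bwd_tens F3 G3 hf hg.
- by move=> ? ?; rewrite F4 G4.
- by rewrite /bwd -(nodeE _ _ (@Cospan 1 2 'I_1 id (fun=> ord0)) _ I1b).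
- by rewrite /bwd -(nodeE _ _ (@Cospan 1 0 'I_1 id (fun=> ord0)) _ I1b).
Qed.
End Generation.

Lemma K_exists_unique (k : fieldType) : exists! K, @K_spec k K.
Proof.
case: (K_exists k) => K HK; exists K; split=> // K' HK'.
have HN m n (mn : (0 < m + n)%N) : H m n (node m n) = one_part mn.
  exact: (H_corel (exist _ _ (@onepart_epic m n mn))).
have HE K0 m n (mn : (0 < m + n)%N) :
    morph_comp K0 H m n (node m n) = K0 m n (one_part mn) :> hom (LagRel k) m n.
  by rewrite -HN.
have e : morph_comp K H = morph_comp K' H.
  apply: cospan_generated.
  - rewrite !(HE _ 2 1 erefl)%N; apply: lag_rel_eq => x y.
    by rewrite (K_mul HK) (K_mul HK').
  - rewrite !(HE _ 1 2 erefl)%N; apply: lag_rel_eq => x y.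
    by rewrite (K_comul HK) (K_comul HK').
  - rewrite !(HE _ 0 1 erefl)%N; apply: lag_rel_eq => x y.
    by rewrite (K_unit HK) (K_unit HK').
  - rewrite !(HE _ 1 0 erefl)%N; apply: lag_rel_eq => x y.
    by rewrite (K_counit HK) (K_counit HK').
apply: prop_morphism_eq => m n f; case: (H_surj f) => {}f <-.
by rewrite -[LHS]/(morph_comp K H _ _ f) e.
Qed.

Definition K (k : fieldType) : prop_morphism FinCorel (LagRel k) :=
  sval (cid (K_exists_unique k)).

Lemma KP (k : fieldType) : K_spec (K k).
Proof. by rewrite /K; case: cid => ? []. Qed.

(* Main.v *)
From mathcomp Require Import all_boot all_order all_algebra.
From mathcomp Require Import ring.
Require Import Defs.

(** A circuit with apex N and edges E is the composite of three layers: a cospan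
    from the inputs to E + N that copies out the source of each edge and keeps
    all nodes, the edges side by side next to identity wires on N, and a cospan
    from E + N to the outputs that glues each edge to its target.  This is
    [circuit_decomposition].

    Uniqueness is immediate from it: a morphism of props out of circuits is
    determined by its values on cospans and on single edges
    ([circuit_generated]).

    For existence, the same three layers are composed in Lagrangian relations
    ([blackbox]), with each edge replaced by its resistor relation; the result is
    Lagrangian because composites and direct sums of Lagrangian relations are.
    Eliminating the intermediate ports shows that it relates the boundary data
    which extend to node potentials and edge currents satisfying Ohm's law on
    the edges and Kirchhoff's current law at the nodes ([related_blackbox]).
    That description does not see the chosen enumerations of nodes and edges, and
    solutions on two circuits agreeing on a shared boundary glue to a solution on
    the composite.  Gluing gives one inclusion between the two sides of each
    functoriality equation, and an inclusion of Lagrangian relations is an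
    equality, so the other inclusion comes for free ([lag_rel_sub]).

    On edgeless circuits the black box is the Kirchhoff relation of a cospan; it
    agrees with the composite of [H] and [K] because both take the prescribed
    values on the four one-node cospans, which generate all cospans. *)

Set Implicit Arguments.
Unset Strict Implicit.
Unset Printing Implicit Defensive.

Import GRing.Theory.

Local Open Scope ring_scope.

(** * Banks of parallel edges *)

Definition copair m n (A : Type) (f : 'I_m -> A) (g : 'I_n -> A)
    (i : 'I_(m + n)) : A :=
  match split i with inl j => f j | inr j => g j end.

Lemma copair_l m n (A : Type) (f : 'I_m -> A) (g : 'I_n -> A) i :
  copair f g (lshift n i) = f i.
Proof. by rewrite /copair -[lshift n i]/(unsplit (inl i)) unsplitK. Qed.

Lemma copair_r m n (A : Type) (f : 'I_m -> A) (g : 'I_n -> A) i :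
  copair f g (rshift m i) = g i.
Proof. by rewrite /copair -[rshift m i]/(unsplit (inr i)) unsplitK. Qed.

(** The type mentions [e] rather than the sum of [e] ones: [1 + e] and [e.+1] are
    convertible, so no transport between arities is needed. *)
Fixpoint bank (Q : prop_ops) (L : Type) (g : L -> hom Q 1 1) (e : nat) :
    ('I_e -> L) -> hom Q e e :=
  match e with
  | 0 => fun=> idm 0
  | e'.+1 => fun l => tensm (g (l ord0)) (bank g (fun j => l (lift ord0 j)))
  end.

Lemma morph_bank (P Q : prop) (F : prop_morphism P Q) (L : Type)
    (g : L -> hom P 1 1) e (l : 'I_e -> L) :
  F e e (bank g l) = bank (fun Z => F 1%N 1%N (g Z)) l.
Proof.
have [F1 _ F3 _] := morphP F.
elim: e l => [|e IH] l /=; first exact: F1.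
by rewrite -IH; exact: (F3 1%N 1%N e e).
Qed.

Lemma eq_bank (Q : prop_ops) (L : Type) (g h : L -> hom Q 1 1) e (l : 'I_e -> L) :
  g =1 h -> bank g l = bank h l.
Proof. by move=> gh; elim: e l => [|e IH] l //=; rewrite gh IH. Qed.

Definition parallel L e (l : 'I_e -> L) : circuit L e e :=
  @Circuit L e e (@Cospan e e (bool * 'I_e)%type (pair false) (pair true))
    'I_e (pair false) (pair true) l.

(** The inductive step splits the indices into the first edge and the others;
    the four maps below are that splitting and its inverse on nodes and on edges. *)
Lemma bank_edges L e (l : 'I_e -> L) :
  bank (fun Z => circuit_class (circuit_edge Z)) l = circuit_class (parallel l).
Proof.
elim: e l => [|e IH] l.
  apply/circP.
  apply: (@circuit_isoI _ _ _ (circuit_of_cospan L (cospan_id 0)) (parallel l)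
    (pair false) snd (of_void _) (fun j => False_rect _ (notF (ltn_ord j)))).
  - by [].
  - by case=> b [].
  - by case.
  - by case.
  - by case.
  - by case.
  - by case.
  - by case.
  - by case.
rewrite -[LHS]/(tensm (circuit_class (circuit_edge (l ord0))) (bank _ _)) IH.
rewrite circ_tens; apply/circP; set c := circuit_tens _ _.
pose F (u : bool + bool * 'I_e) : bool * 'I_(1 + e) :=
  match u with inl b => (b, lshift e ord0) | inr p => (p.1, rshift 1 p.2) end.
pose G (u : bool * 'I_(1 + e)) : bool + bool * 'I_e :=
  match split u.2 with inl _ => inl u.1 | inr j => inr (u.1, j) end.
pose F' (u : unit + 'I_e) : 'I_(1 + e) :=
  match u with inl _ => lshift e ord0 | inr j => rshift 1 j end.
pose G' (i : 'I_(1 + e)) : unit + 'I_e :=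
  match split i with inl _ => inl tt | inr j => inr j end.
have Gl b i : G (b, lshift e i) = inl b.
  by rewrite /G /= -[lshift e i]/(unsplit (inl i)) unsplitK.
have Gr b i : G (b, rshift 1 i) = inr (b, i).
  by rewrite /G /= -[rshift 1 i]/(unsplit (inr i)) unsplitK.
have G'l i : G' (lshift e i) = inl tt.
  by rewrite /G' /= -[lshift e i]/(unsplit (inl i)) unsplitK.
have G'r i : G' (rshift 1 i) = inr i.
  by rewrite /G' /= -[rshift 1 i]/(unsplit (inr i)) unsplitK.
apply: (@circuit_isoI _ _ _ c (parallel l) F G F' G').
- by case=> [b|[b j]] /=; rewrite ?Gl ?Gr.
- by case=> b i; case: (@split_ordP 1 e i) => j ->; rewrite ?Gl ?Gr //= (ord1 j).
- by case=> [[]|j] /=; rewrite ?G'l ?G'r.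
- by move=> i; case: (@split_ordP 1 e i) => j ->; rewrite ?G'l ?G'r //= (ord1 j).
- by move=> i; case: (@split_ordP 1 e i) => j ->; rewrite /= ?tens_leg_l ?tens_leg_r //= (ord1 j).
- by move=> i; case: (@split_ordP 1 e i) => j ->; rewrite /= ?tens_leg_l ?tens_leg_r //= (ord1 j).
- by case.
- by case.
- by case=> [[]|j] /=; congr l; apply/val_inj.
Qed.

(** * Circuits are generated by cospans and edges *)

Section Decomposition.
Variables (L : Type) (m n : nat) (c : circuit L m n).

Definition source_cospan : cospan m (#|edge c| + #|apex c|) :=
  Cospan (lin c) (copair (fun j => src (enum_val j)) enum_val).

Definition target_cospan : cospan (#|edge c| + #|apex c|) n :=
  Cospan (copair (fun j => tgt (enum_val j)) enum_val) (lout c).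

Definition edge_labels (j : 'I_#|edge c|) : L := lab (enum_val j).
End Decomposition.

(** In the double pushout every edge source is glued to its node by the first
    layer and every edge target by the last, while the identity wires glue the two
    copies of the node set; so the apex collapses back to that of [c]. *)
Lemma circuit_decomposition L m n (c : circuit L m n) :
  circuit_class c =
  compm (compm (cospan_to_circ L _ _ (cospan_class (source_cospan c)))
           (tensm (bank (fun Z => circuit_class (circuit_edge Z)) (@edge_labels _ _ _ c))
              (idm #|apex c|)))
        (cospan_to_circ L _ _ (cospan_class (target_cospan c))).
Proof.
rewrite bank_edges [cospan_to_circ L _ _ (cospan_class (source_cospan c))]incl_funE.
rewrite [cospan_to_circ L _ _ (cospan_class (target_cospan c))]incl_funE.
rewrite [tensm _ _]circ_tens.
set A := circuit_of_cospan L (source_cospan c).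
set P := circuit_tens _ _; set B := circuit_of_cospan L (target_cospan c).
rewrite (circ_comp A P) circ_comp; apply/esym/circP.
(* The node of [c] at which a node of the middle layer ends up. *)
pose q (u : bool * 'I_#|edge c| + 'I_#|apex c|) : apex c :=
  match u with
  | inl p => if p.1 then tgt (enum_val p.2) else src (enum_val p.2)
  | inr a => enum_val a
  end.
pose F1 : apex (circuit_comp A P) -> apex c := po_desc id q.
have F1l a : F1 (po_l a) = a.
  rewrite /F1 po_desc_l // => i.
  by case: (split_ordP i) => j -> /=; rewrite ?(copair_l, copair_r) ?(tens_leg_l, tens_leg_r).
have F1r u : F1 (po_r u) = q u.
  rewrite /F1 po_desc_r // => i.
  by case: (split_ordP i) => j -> /=; rewrite ?(copair_l, copair_r) ?(tens_leg_l, tens_leg_r).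
pose F : apex (circuit_comp (circuit_comp A P) B) -> apex c := po_desc F1 id.
have okF i : F1 (lout (circuit_comp A P) i) = id (lin B i).
  by case: (split_ordP i) => j -> /=; rewrite F1r ?(copair_l, copair_r) ?(tens_leg_l, tens_leg_r).
have Fl a : F (po_l a) = F1 a by rewrite /F po_desc_l.
have Fr a : F (po_r a) = a by rewrite /F po_desc_r.
have wire a : po_r (inr a) = po_l (enum_val a) :> apex (circuit_comp A P).
  have := po_glue (lout A) (lin P) (rshift _ a).
  by rewrite /= copair_r tens_leg_r.
have input j : po_r (inl (false, j)) = po_l (src (enum_val j)) :> apex (circuit_comp A P).
  have := po_glue (lout A) (lin P) (lshift _ j).
  by rewrite /= copair_l tens_leg_l.
have outP u : lout (circuit_comp A P) u = po_r (lout P u) by [].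
have right a : po_r a = po_l (po_l a) :> apex (circuit_comp (circuit_comp A P) B).
  have inB : lin B (rshift _ (enum_rank a)) = a.
    by rewrite /B /= copair_r enum_rankK.
  have outPr : lout P (rshift _ (enum_rank a)) = inr (enum_rank a).
    by rewrite /P /= tens_leg_r.
  by rewrite -[in LHS]inB -po_glue outP outPr wire enum_rankK.
have output j : po_l (po_r (inl (true, j))) = po_l (po_l (tgt (enum_val j)))
    :> apex (circuit_comp (circuit_comp A P) B).
  have inB : lin B (lshift _ j) = tgt (enum_val j) by rewrite /B /= copair_l.
  have outPl : lout P (lshift _ j) = inl (true, j) by rewrite /P /= tens_leg_l.
  by rewrite -right -inB -po_glue outP outPl.
pose G : apex c -> apex (circuit_comp (circuit_comp A P) B) := fun a => po_l (po_l a).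
pose F' : edge (circuit_comp (circuit_comp A P) B) -> edge c := fun e =>
  match e with
  | inl (inr (inl j)) => enum_val j
  | inl (inl v) | inl (inr (inr v)) | inr v => of_void _ v
  end.
pose G' : edge c -> edge (circuit_comp (circuit_comp A P) B) := fun e =>
  inl (inr (inl (enum_rank e))).
apply: (@circuit_isoI _ _ _ (circuit_comp (circuit_comp A P) B) c F G F' G').
- move=> x; case: (poP x) => y; last by rewrite Fr right.
  rewrite Fl; case: (poP y) => z; first by rewrite F1l.
  rewrite F1r; case: z => [[[] j]|a]; first exact/esym/output.
    exact: (esym (congr1 po_l (input j))).
  exact: (esym (congr1 po_l (wire a))).
- by move=> a; rewrite Fl F1l.
- by case=> [[[]|[j|[]]]|[]]; rewrite /F' /G' enum_valK.
- exact: enum_rankK.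
- by move=> i /=; rewrite Fl F1l.
- by move=> j /=; rewrite Fr.
- by case=> [[[]|[j|[]]]|[]] /=; rewrite Fl F1r.
- by case=> [[[]|[j|[]]]|[]] /=; rewrite Fl F1r.
- by case=> [[[]|[j|[]]]|[]].
Qed.

(** The uniqueness half of the universal property of circuits as the coproduct of
    cospans with the free prop on the labelled edges. *)
Lemma circuit_generated L (Q : prop) (F G : prop_morphism (Circ L) Q) :
  morph_comp F (cospan_to_circ L) = morph_comp G (cospan_to_circ L) ->
  (forall Z, F 1%N 1%N (circuit_class (circuit_edge Z)) =
             G 1%N 1%N (circuit_class (circuit_edge Z))) ->
  F = G.
Proof.
move=> eFG eZ; have [F1 F2 F3 _] := morphP F; have [G1 G2 G3 _] := morphP G.
have cosp p q (f : hom FinCospan p q) :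
    F p q (cospan_to_circ L p q f) = G p q (cospan_to_circ L p q f).
  by rewrite -[LHS]/(morph_comp F (cospan_to_circ L) p q f) eFG.
apply: prop_morphism_eq => m n f; case: (circ_surj f) => {f}c ->.
rewrite circuit_decomposition !F2 !G2 F3 G3 F1 G1 !cosp !morph_bank.
by rewrite (eq_bank _ eZ).
Qed.

(** * Resistors *)

Section Blackbox.
Variable k : fieldType.
Implicit Types m n p q : nat.

Definition resistor_rel (Z : k) : {vspace ports k 1 * ports k 1} :=
  subspace (fun u => pot u.2 ord0 - pot u.1 ord0 = Z * cur u.1 ord0 /\
                     cur u.1 ord0 = cur u.2 ord0).

Lemma mem_resistor_rel Z x y : (x, y) \in resistor_rel Z <->
  pot y ord0 - pot x ord0 = Z * cur x ord0 /\ cur x ord0 = cur y ord0.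
Proof.
rewrite /resistor_rel; set P := fun u => _.
have linP : linear_pred P.
  split=> [|a [x1 y1] [x2 y2]]; rewrite /P /=.
    by rewrite !pot0 !cur0 mulr0 subr0.
  rewrite !pot_lin !cur_lin => -[/eqP + <-] [/eqP + <-].
  by rewrite !subr_eq => /eqP -> /eqP ->; split=> //; ring.
exact: (mem_subspace linP (x, y)).
Qed.

(** Isotropy reads [I * (Z * I') - I' * (Z * I) = 0].  For maximality, pairing
    against two elements of the relation, a unit potential at both ends and a unit
    current through the resistor, recovers the two defining equations. *)
Lemma resistor_lagrangian Z :
  lagrangian (rel_form (@omega k 1) (@omega k 1)) (resistor_rel Z).
Proof.
have sp := symplectic_rel (omega_symplectic k 1) (omega_symplectic k 1).
have formE (x y x' y' : ports k 1) :
    rel_form (@omega k 1) (@omega k 1) (x, y) (x', y') =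
    - (pot x ord0 * cur x' ord0 - pot x' ord0 * cur x ord0) +
    (pot y ord0 * cur y' ord0 - pot y' ord0 * cur y ord0).
  by rewrite /rel_form /form_sum /form_conj /omega !big_ord1.
apply/(lagrangianP sp); split.
  move=> [x y] [x' y'] /mem_resistor_rel[p c] /mem_resistor_rel[p' c'].
  move/eqP: p; move/eqP: p'; rewrite !subr_eq formE -c -c' => /eqP -> /eqP ->.
  by ring.
move=> [x y] h.
have c : cur x ord0 = cur y ord0.
  have := h (mkports (fun=> 1) (fun=> 0), mkports (fun=> 1) (fun=> 0)).
  rewrite formE !pot_mk !cur_mk => e; apply/eqP; rewrite -subr_eq0 -oppr_eq0.
  apply/eqP; rewrite -[RHS]e; first by ring.
  by apply/mem_resistor_rel; rewrite !pot_mk !cur_mk; split=> //; ring.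
apply/mem_resistor_rel; split=> //.
have := h (mkports (fun=> 0) (fun=> 1), mkports (fun=> Z) (fun=> 1)).
rewrite formE !pot_mk !cur_mk -c => e; apply/eqP; rewrite -subr_eq0 -oppr_eq0.
apply/eqP; rewrite -[RHS]e; first by ring.
by apply/mem_resistor_rel; rewrite !pot_mk !cur_mk; split=> //; ring.
Qed.

Definition resistor (Z : k) : hom (LagRel k) 1 1 :=
  exist _ (resistor_rel Z) (resistor_lagrangian Z).

Lemma related_resistor Z x y : related (resistor Z) x y <->
  pot y ord0 - pot x ord0 = Z * cur x ord0 /\ cur x ord0 = cur y ord0.
Proof. exact: mem_resistor_rel. Qed.

Lemma related_bank e (l : 'I_e -> k) x y :
  related (bank (Q := LagRel k) resistor l) x y <->
  forall j, pot y j - pot x j = l j * cur x j /\ cur x j = cur y j.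
Proof.
elim: e l x y => [|e IH] l x y /=.
  by rewrite related_id; split=> [_ []//|_]; exact: ports0.
have l0 : @lshift 1 e ord0 = ord0 by exact/val_inj.
have rS j : @rshift 1 e j = lift ord0 j by exact/val_inj.
apply: (iff_trans (@related_tens k 1 1 e e (resistor (l ord0)) _ x y)).
rewrite related_resistor IH !pot_lpart !cur_lpart l0; split=> [[h0 hS] j|h].
  case: (unliftP ord0 j) => [j'|] -> //.
  by have := hS j'; rewrite !pot_rpart !cur_rpart rS.
by split=> [|j]; [exact: h|rewrite !pot_rpart !cur_rpart rS; exact: h].
Qed.

(** * The black box of a circuit *)

Definition blackbox m n (c : circuit k m n) : hom (LagRel k) m n :=
  compm (compm (crel k (source_cospan c))
           (tensm (bank (Q := LagRel k) resistor (@edge_labels _ _ _ c)) (idm #|apex c|)))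
        (crel k (target_cospan c)).

(** [v] gives the node potentials and [I] the edge currents, each current oriented
    from source to target; the voltage convention is that of the resistor
    relation, potential at the target minus potential at the source. *)
Definition circuit_law m n (c : circuit k m n) (x : ports k m) (y : ports k n)
    (v : apex c -> k) (I : edge c -> k) : Prop :=
  [/\ forall i, pot x i = v (lin c i),
      forall j, pot y j = v (lout c j),
      forall e, v (tgt e) - v (src e) = lab e * I e &
      forall a, \sum_(i | lin c i == a) cur x i + \sum_(e | tgt e == a) I e =
                \sum_(j | lout c j == a) cur y j + \sum_(e | src e == a) I e].

(** At a node [a] exactly one identity wire arrives, besides the edge ends. *)
Lemma sum_copair (A : finType) e (f : 'I_e -> A) a (z : ports k (e + #|A|)) :
  \sum_(i | copair f enum_val i == a) cur z i =
  \sum_(j | f j == a) cur (lpart z) j + cur (rpart z) (enum_rank a).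
Proof.
rewrite big_mkcond big_split_ord /=; congr (_ + _).
  by rewrite [RHS]big_mkcond; apply: eq_bigr => i _; rewrite copair_l cur_lpart.
rewrite (bigD1 (enum_rank a)) //= copair_r enum_rankK eqxx big1 ?addr0 ?cur_rpart //.
move=> i ne; rewrite copair_r ifN //; apply: contraNneq ne => <-.
by rewrite enum_valK.
Qed.

(** The identity wires force the potentials of the first and last layers to agree.
    The current they carry at a node is determined by the first layer, and feeding
    it into the last one yields Kirchhoff's current law for the whole circuit. *)
Lemma related_blackbox m n (c : circuit k m n) x y :
  related (blackbox c) x y <-> exists v I, @circuit_law m n c x y v I.
Proof.
have reidx (f : edge c -> apex c) a (J : 'I_#|edge c| -> k) :
    \sum_(j | f (enum_val j) == a) J j = \sum_(e | f e == a) J (enum_rank e).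
  rewrite (reindex_onto enum_rank enum_val) /=; last by move=> j _; exact: enum_valK.
  by apply: eq_bigl => e; rewrite enum_rankK eqxx andbT.
rewrite /blackbox (@related_comp k); split.
  move=> [w [/(@related_comp k)[u [/related_crel[[v [vx vu]] hu] /related_tens]]]].
  rewrite related_bank related_id => -[uw eqr] /related_crel[[v' [vw vy]] hw].
  have vv' a : v' a = v a.
    have /= := vu (rshift _ (enum_rank a)); have /= := vw (rshift _ (enum_rank a)).
    by rewrite !copair_r enum_rankK -!pot_rpart eqr => -> ->.
  exists v, (fun e => cur (lpart u) (enum_rank e)); split=> //.
  - by move=> j; rewrite vy vv'.
  - move=> e; have /= := vu (lshift _ (enum_rank e)); have /= := vw (lshift _ (enum_rank e)).
    rewrite !copair_l enum_rankK vv' => <- <-; rewrite -!pot_lpart.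
    by case: (uw (enum_rank e)) => -> _; rewrite /edge_labels enum_rankK.
  - move=> a; rewrite -(hw a) (hu a) /= !sum_copair eqr -!reidx.
    rewrite addrAC [RHS]addrAC; congr (_ + _); rewrite addrC; congr (_ + _).
    by apply: eq_bigr => j _; case: (uw j).
move=> [v [I [vx vy ohm kcl]]].
(* The current that the identity wire at [a] has to carry. *)
pose thru a := \sum_(i | lin c i == a) cur x i - \sum_(e | src e == a) I e.
pose u : ports k (#|edge c| + #|apex c|) :=
  mkports (copair (fun j => v (src (enum_val j))) (fun a => v (enum_val a)))
          (copair (fun j => I (enum_val j)) (fun a => thru (enum_val a))).
pose w : ports k (#|edge c| + #|apex c|) :=
  mkports (copair (fun j => v (tgt (enum_val j))) (fun a => v (enum_val a)))
          (copair (fun j => I (enum_val j)) (fun a => thru (enum_val a))).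
have curI (f : edge c -> apex c) a (z : ports k (#|edge c| + #|apex c|)) :
    (forall j, cur (lpart z) j = I (enum_val j)) ->
    \sum_(j | f (enum_val j) == a) cur (lpart z) j = \sum_(e | f e == a) I e.
  by move=> zI; rewrite reidx; apply: eq_bigr => e _; rewrite zI enum_rankK.
exists w; split; last first.
  apply/related_crel; split; first exists v.
    by split=> // i; case: (split_ordP i) => j ->; rewrite pot_mk /= !(copair_l, copair_r).
  move=> a; rewrite sum_copair curI => [|j]; last by rewrite cur_lpart cur_mk copair_l.
  rewrite cur_rpart cur_mk copair_r enum_rankK /thru addrC addrAC kcl.
  by rewrite addrK.
apply/(@related_comp k); exists u; split.
  apply/related_crel; split; first exists v.
    by split=> // i; case: (split_ordP i) => j ->; rewrite pot_mk /= !(copair_l, copair_r).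
  move=> a; rewrite sum_copair curI => [|j]; last by rewrite cur_lpart cur_mk copair_l.
  by rewrite cur_rpart cur_mk copair_r enum_rankK /thru addrC subrK.
apply/related_tens; rewrite related_bank related_id; split=> [j|].
  by rewrite !pot_lpart !cur_lpart !pot_mk !cur_mk !copair_l; split=> //; exact: ohm.
by apply/ffunP => a; rewrite !ffunE !copair_r.
Qed.

(** * Functoriality *)

(** Current is conserved not only at nodes but also when nodes are merged, by
    adding up the conservation laws over each fibre of the merging map. *)
Lemma circuit_law_push m n (c : circuit k m n) x y v I (B : finType)
    (f : apex c -> B) b :
  circuit_law x y v I ->
  \sum_(i | f (lin c i) == b) cur x i + \sum_(e | f (tgt e) == b) I e =
  \sum_(j | f (lout c j) == b) cur y j + \sum_(e | f (src e) == b) I e.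
Proof.
move=> [_ _ _ kcl]; rewrite (sum_pred_comp (lin c) f) (sum_pred_comp (lout c) f).
rewrite (sum_pred_comp (@tgt _ _ _ c) f) (sum_pred_comp (@src _ _ _ c) f) -!big_split /=.
by apply: eq_bigr => a _; exact: kcl.
Qed.

Lemma blackbox_iso m n (c d : circuit k m n) :
  circuit_iso c d -> blackbox c = blackbox d.
Proof.
move=> [f [g [[[f' fK f'K] f1 f2] [[g' gK g'K] g1 g2 g3]]]].
apply: lag_rel_sub => x y /related_blackbox[v [I law]]; apply/related_blackbox.
have push := circuit_law_push f _ law; case: law => vx vy ohm _.
have reidx (t : edge d -> apex d) a :
    \sum_(e | t e == a) I (g' e) = \sum_(e | t (g e) == a) I e.
  rewrite (reindex g) /=; last by exists g' => e _.
  by apply: eq_bigr => e _; rewrite gK.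
exists (v \o f'), (I \o g'); split=> /=.
- by move=> i; rewrite -f1 fK.
- by move=> j; rewrite -f2 fK.
- by move=> e; rewrite -(g'K e) -g1 -g2 -g3 !fK gK; exact: ohm.
- move=> a; rewrite !reidx; move: (push a).
  by congr (_ + _ = _ + _); apply: eq_bigl => e; rewrite ?(f1, f2, g1, g2).
Qed.

Lemma blackbox_cospan m n (c : cospan m n) :
  blackbox (circuit_of_cospan k c) = crel k c.
Proof.
apply: lag_rel_sub => x y /related_blackbox[v [I [vx vy _ kcl]]].
apply/related_crel; split; first by exists v.
by move=> a; have := kcl a; rewrite ![\sum_(e : void | _) _]big1 ?addr0 // => -[].
Qed.

Lemma blackbox_edge Z : blackbox (circuit_edge Z) = resistor Z.
Proof.
apply/esym/lag_rel_sub => x y /related_resistor[ohm cxy]; apply/related_blackbox.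
exists (fun b => if b then pot y ord0 else pot x ord0), (fun=> cur x ord0).
split=> //= [i|i|a]; rewrite ?ord1 //.
have sum_ord1 (b : bool) (F : 'I_1 -> k) :
    \sum_(i < 1 | b) F i = if b then F ord0 else 0.
  by case: b; rewrite ?big_ord1 ?big_pred0_eq.
have sum_unit (b : bool) (t : k) : \sum_(e : unit | b) t = if b then t else 0.
  by case: b; rewrite ?big_pred0_eq // big_const card_unit /= addr0.
by rewrite !sum_ord1 !sum_unit cxy; case: a; rewrite /= ?addr0 ?add0r.
Qed.

(** Potentials glue over the pushout; currents balance at a glued node because what
    leaves the first circuit along the shared terminals enters the second. *)
Lemma blackbox_comp m n p (c : circuit k m n) (d : circuit k n p) :
  blackbox (circuit_comp c d) = compm (blackbox c) (blackbox d).
Proof.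
apply/esym/lag_rel_sub => x z /related_comp[y].
move=> [/related_blackbox[v [I law]] /related_blackbox[w [J law']]].
apply/related_blackbox.
have push a := circuit_law_push (@po_l _ _ _ (lout c) (lin d)) a law.
have push' a := circuit_law_push (@po_r _ _ _ (lout c) (lin d)) a law'.
case: law => vx vy ohm _; case: law' => wy wz ohm' _.
have ok j : v (lout c j) = w (lin d j) by rewrite -vy wy.
exists (po_desc v w), (fun e => match e with inl e => I e | inr e => J e end).
split=> /=.
- by move=> i; rewrite po_desc_l.
- by move=> i; rewrite po_desc_r.
- by case=> e; rewrite ?(po_desc_l ok) ?(po_desc_r ok).
- move=> a; rewrite !big_sumType /= addrA push.
  rewrite (eq_bigl (fun j => po_r (lin d j) == a)) => [|j]; last by rewrite po_glue.
  by rewrite addrAC push' addrAC addrA.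
Qed.

Lemma sum_tens_leg_l p q (A B : finType) (f : 'I_p -> A) (g : 'I_q -> B)
    (z : ports k (p + q)) a :
  \sum_(i | tens_leg f g i == inl a) cur z i = \sum_(i | f i == a) cur (lpart z) i.
Proof.
rewrite big_mkcond big_split_ord /= [X in _ + X]big1 => [|i _]; last by rewrite tens_leg_r.
rewrite addr0 [RHS]big_mkcond; apply: eq_bigr => i _.
by rewrite tens_leg_l cur_lpart (inj_eq (@inl_inj _ _)).
Qed.

Lemma sum_tens_leg_r p q (A B : finType) (f : 'I_p -> A) (g : 'I_q -> B)
    (z : ports k (p + q)) b :
  \sum_(i | tens_leg f g i == inr b) cur z i = \sum_(i | g i == b) cur (rpart z) i.
Proof.
rewrite big_mkcond big_split_ord /= big1 => [|i _]; last by rewrite tens_leg_l.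
rewrite add0r [RHS]big_mkcond; apply: eq_bigr => i _.
by rewrite tens_leg_r cur_rpart (inj_eq (@inr_inj _ _)).
Qed.

Lemma blackbox_tens m n m' n' (c : circuit k m n) (d : circuit k m' n') :
  blackbox (circuit_tens c d) = tensm (blackbox c) (blackbox d).
Proof.
apply/esym/lag_rel_sub => x y /related_tens.
move=> [/related_blackbox[v [I [vx vy ohm kcl]]] /related_blackbox[w [J [wx wy ohm' kcl']]]].
apply/related_blackbox.
exists (fun u => match u with inl a => v a | inr b => w b end).
exists (fun e => match e with inl e => I e | inr e => J e end); split.
- move=> i; case: (split_ordP i) => j -> /=; rewrite ?tens_leg_l ?tens_leg_r.
    by rewrite -vx pot_lpart.
  by rewrite -wx pot_rpart.
- move=> i; case: (split_ordP i) => j -> /=; rewrite ?tens_leg_l ?tens_leg_r.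
    by rewrite -vy pot_lpart.
  by rewrite -wy pot_rpart.
- by case.
- case=> a; rewrite /= !big_sumType /=.
    rewrite !sum_tens_leg_l [X in _ + (_ + X)]big1 // [X in _ = _ + (_ + X)]big1 //.
    rewrite !addr0; move: (kcl a).
    by congr (_ + _ = _ + _); apply: eq_bigl => e; rewrite (inj_eq (@inl_inj _ _)).
  rewrite !sum_tens_leg_r [X in _ + (X + _)]big1 // [X in _ = _ + (X + _)]big1 //.
  rewrite !add0r; move: (kcl' a).
  by congr (_ + _ = _ + _); apply: eq_bigl => e; rewrite (inj_eq (@inr_inj _ _)).
Qed.

Definition blackbox_class m n (f : hom (Circ k) m n) : hom (LagRel k) m n :=
  blackbox (qrepr f).

Lemma blackbox_classE m n (c : circuit k m n) :
  blackbox_class (circuit_class c) = blackbox c.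
Proof. by apply: blackbox_iso; apply: repr_cls (circuit_eqv _ _ _) _. Qed.

Lemma blackbox_is_morphism : @is_prop_morphism (Circ k) (LagRel k) blackbox_class.
Proof.
split.
- by move=> m; rewrite [LHS]blackbox_classE blackbox_cospan crel_id.
- move=> m n p f g; case: (circ_surj f) => {f}c ->; case: (circ_surj g) => {g}d ->.
  by rewrite [compm _ _]circ_comp !blackbox_classE blackbox_comp.
- move=> m n p q f g; case: (circ_surj f) => {f}c ->; case: (circ_surj g) => {g}d ->.
  by rewrite [tensm _ _]circ_tens !blackbox_classE blackbox_tens.
- by move=> m n; rewrite [LHS]blackbox_classE blackbox_cospan crel_sym.
Qed.

Definition blackbox_morphism : prop_morphism (Circ k) (LagRel k) :=
  @PropMorphism (Circ k) (LagRel k) _ blackbox_is_morphism.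

(** * Agreement with the corelation functor on cospans *)

Lemma K_node m n (mn : (0 < m + n)%N) :
  morph_comp (K k) H m n (node m n) = K k m n (one_part mn).
Proof.
exact: (congr1 (K k m n) (H_corel (exist _ _ (@onepart_epic m n mn)))).
Qed.

Lemma blackbox_node m n :
  morph_comp blackbox_morphism (cospan_to_circ k) m n (node m n) =
  crel k (@Cospan m n unit (fun=> tt) (fun=> tt)).
Proof.
rewrite -blackbox_cospan -blackbox_classE; congr blackbox_class.
exact: incl_funE.
Qed.

Lemma related_one_node m n (x : ports k m) (y : ports k n) u :
  (forall i, pot x i = u) -> (forall j, pot y j = u) ->
  \sum_i cur x i = \sum_j cur y j ->
  related (crel k (@Cospan m n unit (fun=> tt) (fun=> tt))) x y.
Proof.
move=> xu yu xy; apply/related_crel; split; first by exists (fun=> u).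
by case; exact: xy.
Qed.

(** [K] is known only through its values on four corelations, which are the images
    of the one-node cospans; these generate, so checking them suffices. *)
Lemma blackbox_restricts_to_K :
  morph_comp blackbox_morphism (cospan_to_circ k) = morph_comp (K k) H.
Proof.
have HK := KP k.
have all2 (P : 'I_2 -> Prop) : P ord0 -> P ord_max -> forall i, P i.
  by move=> P0 P1 [[|[|//]] hi]; [move: P0|move: P1]; congr P; exact/val_inj.
have sum2 (F : 'I_2 -> k) : \sum_i F i = F ord0 + F ord_max.
  by rewrite !big_ord_recl big_ord0 addr0; congr (_ + F _); exact/val_inj.
have all1 (P : 'I_1 -> Prop) : P ord0 -> forall i, P i.
  by move=> P0 i; rewrite (ord1 i).
apply: cospan_generated; rewrite blackbox_node.
- rewrite (@K_node 2 1 erefl); apply/esym/lag_rel_sub => x y /(K_mul HK)[e1 e2 e3].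
  apply: (@related_one_node _ _ _ _ (pot y ord0)); rewrite ?sum2 ?big_ord1 //.
    by apply: all2; rewrite ?e1.
  exact: all1.
- rewrite (@K_node 1 2 erefl); apply/esym/lag_rel_sub => x y /(K_comul HK)[e1 e2 e3].
  apply: (@related_one_node _ _ _ _ (pot x ord0)); rewrite ?sum2 ?big_ord1 //.
    exact: all1.
  by apply: all2; rewrite -?e2.
- rewrite (@K_node 0 1 erefl); apply/esym/lag_rel_sub => x y /(K_unit HK) e.
  apply: (@related_one_node _ _ _ _ (pot y ord0)); rewrite ?big_ord1 ?big_ord0 //.
    by case.
  exact: all1.
- rewrite (@K_node 1 0 erefl); apply/esym/lag_rel_sub => x y /(K_counit HK) e.
  apply: (@related_one_node _ _ _ _ (pot x ord0)); rewrite ?big_ord1 ?big_ord0 //.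
    exact: all1.
  by case.
Qed.
End Blackbox.

(** * Existence and uniqueness *)

Theorem theorem4p2p4 (k : fieldType) :
  exists! blacksquare : prop_morphism (Circ k) (LagRel k),
    morph_comp blacksquare (cospan_to_circ k) = morph_comp (K k) H /\
    forall (Z : k) (x y : ports k 1),
      related (blacksquare 1 1 (circuit_class (circuit_edge Z)))%N x y <->
      pot y ord0 - pot x ord0 = Z * cur x ord0 /\ cur x ord0 = cur y ord0.
Proof.
have bbZ Z : blackbox_class (circuit_class (circuit_edge Z)) = resistor Z.
  by rewrite blackbox_classE blackbox_edge.
exists (blackbox_morphism k); split.
  split=> [|Z x y]; first exact: blackbox_restricts_to_K.
  by rewrite [_ _ _ (circuit_class _)]bbZ; exact: related_resistor.
move=> F [FK FZ]; apply: circuit_generated.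
  by rewrite FK; exact: blackbox_restricts_to_K.
move=> Z; rewrite [LHS]bbZ; apply: lag_rel_eq => x y.
by rewrite FZ; exact: related_resistor.
Qed.
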